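(* Let $n\in\{1,2,3,\dots\}$, $p\in\{2,3,\dots\}$ and $\Delta\in\{0,1,2,\dots\}$. Then for every $s\in\mathbb{C}$ with $\operatorname{Re} s>1-\Delta$ and $s\neq 1$, the series over $i$ below converges and $$\zeta(s)=\sum_{j=1}^{n}\frac{1}{j^{s}}+\sum_{k=0}^{\Delta-1}\frac{\binom{s+k-2}{k}}{s-1}\,\frac{B_k}{n^{s+k-1}}+\frac{1}{(s-1)\,n^{s}}\sum_{i=\Delta}^{\infty}\frac{\binom{i+s-1}{i+1}}{(n p)^{i}}\sum_{j=\Delta}^{i}\binom{i+1}{j}B_j\,\frac{\bigl(n(p-1)\bigr)^{i+1-j}}{p^{s}-p^{1-j}} .$$
   Context: $\zeta$ denotes the Riemann zeta function, meromorphically continued to $\mathbb{C}$ with its only pole (simple, residue $1$) at $1$. $B_k$ are the Bernoulli numbers with $B_0=1$, $B_1=-\tfrac12$, $B_2=\tfrac16$, and $\sum_{k=0}^{m}\binom{m+1}{k}B_k=0$ for $m\ge 1$. For $z\in\mathbb{C}$ and an integer $r\ge 0$, $\binom{z}{r}=\frac{z(z-1)\cdots(z-r+1)}{r!}$ is the generalized binomial coefficient (equal to $1$ for $r=0$). Empty sums (e.g. $\sum_{k=0}^{-1}$) are $0$. The double sum is an iterated sum: for each $i$ the finite inner sum over $j$ is taken first, and then the infinite series over $i$ is summed in this order. *)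

(* Defs.v *)
From Stdlib Require Import Reals Arith Lia.
From Coquelicot Require Import Coquelicot.

Definition Cexp (z : C) : C :=
  (RtoC (exp (Re z)) * (cos (Im z), sin (Im z)))%C.

(* Principal complex power m^s; the intended bases are positive integers. *)
Definition npow (m : nat) (s : C) : C := Cexp (s * RtoC (ln (INR m))).

(* The functions with these properties are exactly those equal to the Riemann
   zeta function off 1: it is the only continuation of the Dirichlet series
   that is holomorphic on the connected set C \ {1}.  The value at 1 is left
   unconstrained. *)
Definition is_zeta (zeta : C -> C) : Prop :=
  (forall s : C, (1 < Re s)%R ->
     is_series (fun k : nat => (/ npow (S k) s)%C) (zeta s)) /\
  (forall s : C, s <> RtoC 1 -> ex_derive (K := C_AbsRing) zeta s) /\
  filterlim (fun s : C => ((s - 1) * zeta s)%C)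
            (locally' (RtoC 1)) (locally (RtoC 1)).

(* [sum_n f m] has m + 1 terms; this is the sum over k < m, empty for m = 0. *)
Definition sum_lt (f : nat -> C) (m : nat) : C :=
  match m with
  | O => RtoC 0
  | S m' => sum_n f m'
  end.

(* [bernoulli_upto m k] is B_k for k <= m; its values for k > m are junk. *)
Fixpoint bernoulli_upto (m : nat) : nat -> R :=
  match m with
  | O => fun _ => 1%R
  | S m' =>
      let b := bernoulli_upto m' in
      fun k => if k <=? m' then b k
               else (- / INR (m' + 2)
                     * sum_f_R0 (fun l => Binomial.C (m' + 2) l * b l) m')%R
  end.

Definition bernoulli (k : nat) : R := bernoulli_upto k k.

Fixpoint falling (z : C) (r : nat) : C :=
  match r with
  | O => RtoC 1
  | S r' => (falling z r' * (z - RtoC (INR r')))%C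
  end.

Definition Cbinom (z : C) (r : nat) : C :=
  (falling z r / RtoC (INR (fact r)))%C.

Local Open Scope nat_scope.

Lemma bernoulli_upto_stable (m k : nat) :
  k <= m -> bernoulli_upto m k = bernoulli k.
Proof.
  induction m as [|m IH]; intros Hk.
  - now replace k with 0 by lia.
  - destruct (Nat.eq_dec k (S m)) as [->|Hne]; [reflexivity|].
    simpl; destruct (Nat.leb_spec k m) as [H|H]; [now apply IH | lia].
Qed.

Lemma bernoulli_0 : bernoulli 0 = 1%R.
Proof. reflexivity. Qed.

Lemma bernoulli_rec (m : nat) :
  1 <= m ->
  sum_f_R0 (fun k => Binomial.C (m + 1) k * bernoulli k)%R m = 0%R.
Proof.
  destruct m as [|m]; intros Hm; [lia|].
  replace (S m + 1) with (m + 2) by lia.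
  rewrite tech5.
  assert (HB : bernoulli (S m) = (- / INR (m + 2)
    * sum_f_R0 (fun l => Binomial.C (m + 2) l * bernoulli l) m)%R).
  { unfold bernoulli at 1; cbn [bernoulli_upto].
    destruct (Nat.leb_spec (S m) m) as [H|_]; [lia|].
    f_equal; apply sum_eq; intros i Hi.
    now rewrite bernoulli_upto_stable. }
  rewrite HB.
  assert (HC : Binomial.C (m + 2) (S m) = INR (m + 2)).
  { unfold Binomial.C.
    replace (m + 2 - S m) with 1 by lia.
    replace (m + 2) with (S (S m)) by lia.
    rewrite (fact_simpl (S m)), mult_INR.
    change (INR (fact 1)) with 1%R.
    field; apply INR_fact_neq_0. }
  rewrite HC; field.
  apply not_0_INR; lia.
Qed.

(* Main.v *)
Require Import Defs.
From Stdlib Require Import Reals Arith Lia Lra Psatz ClassicalEpsilon.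
From Coquelicot Require Import Coquelicot.
Open Scope R_scope.

(* Cut the integers above n into the blocks (N, N p] with N = n p^k. In one block
   put m' = N p - m, expand m'^(-s) = (N p)^(-s) (1 - m/(N p))^(-s) by the binomial
   series, and sum the powers of m by Faulhaber's formula; the Bernoulli terms with
   j < D sum to multiples of N^(1-s-j) - (N p)^(1-s-j), which telescope over k. The
   remaining part Q_i(M) = sum_(D <= j <= i) binom(i+1, j) B_j M^(i+1-j), M = N (p-1),
   satisfies |Q_i(M)| <= K binom(i+1, D+1) M^(i+1-D): its difference in M has no terms
   of order above i - D. So the double series over k and i is dominated by a product
   of summable sequences when Re s > 1 - D, and summing over k first, a geometric
   series for each j, gives the denominators p^s - p^(1-j). This proves the formula
   for Re s > 1, and shows that the series over i is a locally uniform limit of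
   holomorphic functions for Re s > 1 - D.

   For the continuation, Goursat's theorem in the coordinate log (z - a) gives
   |H(a)| <= 2 max |H| on a circle around a. Applied to H times a large power of a
   weight that is small on most of the circle, it shows that a uniform limit of
   holomorphic functions which vanishes on the remaining arc vanishes at a. In the
   coordinate log (z - c), zeros spread from a neighbourhood of c to every disc around
   c, and a chain of discs avoiding 1 reaches every s. *)

(** * Complex differentiability *)

(** Blocks of ratio [p] make the double series separate: [M / (N p) = (p - 1) / p] is the same
    number below 1 in every block. The expansions of all blocks therefore converge at one common
    rate in [i], and [k] enters the majorant only through a power of [N p] with exponent
    [1 - D - Re s]. Its summability over [k] is where the half-plane [Re s > 1 - D] comes from.

    The obstacle is the growth of the Bernoulli numbers: for even [j], [B_j] has size about
    [j! / (2 pi)^j], so single terms of [Q_i] grow factorially in [i] and cannot be bounded one by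
    one. Their sum over [j] is much smaller, as Faulhaber's formula shows. The bound on [Q_i] is
    therefore read off from its difference equation in [M]; only the values [B_j] with [j < D] enter
    its constant.

    The double series converges absolutely on the whole half-plane, but its sum by rows is tied to
    [zeta] through the Dirichlet series, hence for [Re s > 1]. To the left of that line the identity
    has to be transported by uniqueness. *)

Definition ccont (f : C -> C) (z : C) : Prop :=
  forall eps : R, 0 < eps -> exists del : R, 0 < del /\
    forall w : C, Cmod (w - z) < del -> Cmod (f w - f z) < eps.

(* Caratheodory's form of complex differentiability. *)
Definition cdiff (f : C -> C) (z : C) : Prop :=
  exists phi : C -> C, ccont phi z /\
    exists del : R, 0 < del /\
      forall w : C, Cmod (w - z) < del -> (f w - f z = phi w * (w - z))%C.

Lemma Cmod_triangle_minus (x y : C) : Cmod x <= Cmod (x - y) + Cmod y.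
Proof.
replace x with ((x - y) + y)%C at 1 by ring; apply Cmod_triangle.
Qed.

Lemma Cmod_minus_sym (x y : C) : Cmod (x - y) = Cmod (y - x).
Proof. rewrite <- Cmod_opp; f_equal; ring. Qed.

Lemma ccont_const (c z : C) : ccont (fun _ => c) z.
Proof.
intros eps He; exists 1; split; [lra|]; intros w _.
replace (c - c)%C with (RtoC 0) by ring; rewrite Cmod_0; lra.
Qed.

Lemma ccont_id (z : C) : ccont (fun w => w) z.
Proof. intros eps He; exists eps; split; auto. Qed.

Lemma ccont_plus (f g : C -> C) (z : C) :
  ccont f z -> ccont g z -> ccont (fun w => f w + g w)%C z.
Proof.
intros Hf Hg eps He.
destruct (Hf (eps / 2)) as [d1 [Hd1 H1]]; [lra|].
destruct (Hg (eps / 2)) as [d2 [Hd2 H2]]; [lra|].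
exists (Rmin d1 d2); split; [now apply Rmin_pos|]; intros w Hw.
assert (A1 := H1 w (Rlt_le_trans _ _ _ Hw (Rmin_l _ _))).
assert (A2 := H2 w (Rlt_le_trans _ _ _ Hw (Rmin_r _ _))).
replace (f w + g w - (f z + g z))%C with ((f w - f z) + (g w - g z))%C by ring.
eapply Rle_lt_trans; [apply Cmod_triangle|lra].
Qed.

Lemma ccont_mult (f g : C -> C) (z : C) :
  ccont f z -> ccont g z -> ccont (fun w => f w * g w)%C z.
Proof.
intros Hf Hg eps He.
assert (Pf := Cmod_ge_0 (f z)); assert (Pg := Cmod_ge_0 (g z)).
set (M := Cmod (f z) + Cmod (g z) + 1).
assert (HM : 0 < M) by (unfold M; lra).
set (e := Rmin 1 (eps / (2 * M))).
assert (He0 : 0 < e).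
{ apply Rmin_pos; [lra|]; apply Rdiv_lt_0_compat; lra. }
destruct (Hf e He0) as [d1 [Hd1 H1]].
destruct (Hg e He0) as [d2 [Hd2 H2]].
exists (Rmin d1 d2); split; [now apply Rmin_pos|]; intros w Hw.
assert (A1 := H1 w (Rlt_le_trans _ _ _ Hw (Rmin_l _ _))).
assert (A2 := H2 w (Rlt_le_trans _ _ _ Hw (Rmin_r _ _))).
replace (f w * g w - f z * g z)%C
  with ((f w - f z) * (g w - g z) + (f z * (g w - g z) + (f w - f z) * g z))%C by ring.
eapply Rle_lt_trans; [apply Cmod_triangle|].
eapply Rle_lt_trans; [apply Rplus_le_compat_l, Cmod_triangle|].
rewrite !Cmod_mult.
assert (E1 : e <= 1) by apply Rmin_l.
assert (E2 : e * M <= eps / 2).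
{ apply Rle_trans with (eps / (2 * M) * M).
  - apply Rmult_le_compat_r; [lra|apply Rmin_r].
  - right; field; lra. }
assert (P1 := Cmod_ge_0 (f w - f z)); assert (P2 := Cmod_ge_0 (g w - g z)).
unfold M in E2; nra.
Qed.

Lemma ccont_comp (f g : C -> C) (z : C) :
  ccont g z -> ccont f (g z) -> ccont (fun w => f (g w)) z.
Proof.
intros Hg Hf eps He.
destruct (Hf eps He) as [d1 [Hd1 H1]].
destruct (Hg d1 Hd1) as [d2 [Hd2 H2]].
exists d2; split; auto.
Qed.

(** The neighbourhood without zeros is exported because [cdiff_inv] divides by [f w] on it. *)
Lemma ccont_inv (f : C -> C) (z : C) :
  f z <> RtoC 0 -> ccont f z ->
  ccont (fun w => / f w)%C z /\
  exists del : R, 0 < del /\ forall w : C, Cmod (w - z) < del -> f w <> RtoC 0.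
Proof.
intros Hz Hf.
assert (Hm : 0 < Cmod (f z)) by now apply Cmod_gt_0.
destruct (Hf (Cmod (f z) / 2)) as [d1 [Hd1 H1]]; [lra|].
assert (B : forall w, Cmod (w - z) < d1 -> Cmod (f z) / 2 < Cmod (f w)).
{ intros w Hw; specialize (H1 w Hw).
  assert (A := Cmod_triangle_minus (f z) (f w)); rewrite Cmod_minus_sym in A; lra. }
assert (N : forall w, Cmod (w - z) < d1 -> f w <> RtoC 0).
{ intros w Hw; apply Cmod_gt_0; specialize (B w Hw); lra. }
split; [|now exists d1; split].
intros eps He.
set (m := Cmod (f z)) in *.
destruct (Hf (eps * (m * m / 2))) as [d2 [Hd2 H2]].
{ apply Rmult_lt_0_compat; [lra|nra]. }
exists (Rmin d1 d2); split; [now apply Rmin_pos|]; intros w Hw.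
assert (W1 := Rlt_le_trans _ _ _ Hw (Rmin_l _ _)).
assert (W2 := H2 w (Rlt_le_trans _ _ _ Hw (Rmin_r _ _))).
assert (Nw := N w W1).
replace (/ f w - / f z)%C with ((f z - f w) / (f w * f z))%C by (field; auto).
rewrite Cmod_div by (now apply Cmult_neq_0).
rewrite Cmod_mult, Cmod_minus_sym; fold m.
assert (Bw := B w W1).
apply Rlt_le_trans with (eps * (m * m / 2) / (Cmod (f w) * m)).
- apply Rmult_lt_compat_r; [apply Rinv_0_lt_compat; nra|exact W2].
- assert (Pm : 0 < Cmod (f w) * m) by nra.
  apply Rle_div_l; [exact Pm|].
  assert (0 <= (Cmod (f w) - m / 2) * m) by nra; nra.
Qed.

Lemma cdiff_ccont (f : C -> C) (z : C) : cdiff f z -> ccont f z.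
Proof.
intros [phi [Hphi [d [Hd H]]]] eps He.
assert (K : ccont (fun w => phi w * (w - z))%C z).
{ apply ccont_mult; [exact Hphi|].
  apply ccont_plus; [apply ccont_id|apply ccont_const]. }
destruct (K eps He) as [d2 [Hd2 H2]].
exists (Rmin d d2); split; [now apply Rmin_pos|]; intros w Hw.
rewrite H by (eapply Rlt_le_trans; [exact Hw|apply Rmin_l]).
specialize (H2 w (Rlt_le_trans _ _ _ Hw (Rmin_r _ _))).
now replace (phi w * (w - z))%C with (phi w * (w - z) - phi z * (z - z))%C by ring.
Qed.

Lemma cdiff_const (c z : C) : cdiff (fun _ => c) z.
Proof.
exists (fun _ => RtoC 0); split; [apply ccont_const|].
exists 1; split; [lra|]; intros; ring.
Qed.

Lemma cdiff_id (z : C) : cdiff (fun w => w) z.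
Proof.
exists (fun _ => RtoC 1); split; [apply ccont_const|].
exists 1; split; [lra|]; intros; ring.
Qed.

Lemma cdiff_plus (f g : C -> C) (z : C) :
  cdiff f z -> cdiff g z -> cdiff (fun w => f w + g w)%C z.
Proof.
intros [p1 [Hp1 [d1 [Hd1 H1]]]] [p2 [Hp2 [d2 [Hd2 H2]]]].
exists (fun w => p1 w + p2 w)%C; split; [now apply ccont_plus|].
exists (Rmin d1 d2); split; [now apply Rmin_pos|]; intros w Hw.
assert (A1 := H1 w (Rlt_le_trans _ _ _ Hw (Rmin_l _ _))).
assert (A2 := H2 w (Rlt_le_trans _ _ _ Hw (Rmin_r _ _))).
replace (f w + g w - (f z + g z))%C with ((f w - f z) + (g w - g z))%C by ring.
rewrite A1, A2; ring.
Qed.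

Lemma cdiff_mult (f g : C -> C) (z : C) :
  cdiff f z -> cdiff g z -> cdiff (fun w => f w * g w)%C z.
Proof.
intros Df Dg; assert (Cf := cdiff_ccont _ _ Df).
destruct Df as [p1 [Hp1 [d1 [Hd1 H1]]]]; destruct Dg as [p2 [Hp2 [d2 [Hd2 H2]]]].
exists (fun w => p1 w * g z + f w * p2 w)%C; split.
{ apply ccont_plus; apply ccont_mult; auto using ccont_const. }
exists (Rmin d1 d2); split; [now apply Rmin_pos|]; intros w Hw.
assert (A1 := H1 w (Rlt_le_trans _ _ _ Hw (Rmin_l _ _))).
assert (A2 := H2 w (Rlt_le_trans _ _ _ Hw (Rmin_r _ _))).
replace (f w * g w - f z * g z)%C
  with ((f w - f z) * g z + f w * (g w - g z))%C by ring.
rewrite A1, A2; ring.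
Qed.

Lemma cdiff_ext (f g : C -> C) (z : C) :
  (forall w, f w = g w) -> cdiff f z -> cdiff g z.
Proof.
intros E [p [Hp [d [Hd H]]]].
exists p; split; [exact Hp|]; exists d; split; [exact Hd|].
intros w Hw; rewrite <- !E; auto.
Qed.

Lemma cdiff_opp (f : C -> C) (z : C) : cdiff f z -> cdiff (fun w => - f w)%C z.
Proof.
intros Df; apply cdiff_ext with (fun w => RtoC (-1) * f w)%C.
- intros w; apply injective_projections; simpl; ring.
- apply cdiff_mult; [apply cdiff_const|exact Df].
Qed.

Lemma cdiff_minus (f g : C -> C) (z : C) :
  cdiff f z -> cdiff g z -> cdiff (fun w => f w - g w)%C z.
Proof. intros; apply cdiff_plus; [|apply cdiff_opp]; assumption. Qed.

Lemma cdiff_inv (f : C -> C) (z : C) :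
  f z <> RtoC 0 -> cdiff f z -> cdiff (fun w => / f w)%C z.
Proof.
intros Hz Df; destruct (ccont_inv f z Hz (cdiff_ccont _ _ Df)) as [Ci [d2 [Hd2 H2]]].
destruct Df as [p [Hp [d1 [Hd1 H1]]]].
exists (fun w => - / f z * (p w * / f w))%C; split.
{ apply ccont_mult; [apply ccont_const|now apply ccont_mult]. }
exists (Rmin d1 d2); split; [now apply Rmin_pos|]; intros w Hw.
assert (A1 := H1 w (Rlt_le_trans _ _ _ Hw (Rmin_l _ _))).
assert (A2 := H2 w (Rlt_le_trans _ _ _ Hw (Rmin_r _ _))).
replace (- / f z * (p w * / f w) * (w - z))%C
  with (- / f z * / f w * (p w * (w - z)))%C by ring.
rewrite <- A1; field; auto.
Qed.

Lemma cdiff_comp (f g : C -> C) (z : C) :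
  cdiff g z -> cdiff f (g z) -> cdiff (fun w => f (g w)) z.
Proof.
intros Dg Df; assert (Cg := cdiff_ccont _ _ Dg).
destruct Df as [p1 [Hp1 [d1 [Hd1 H1]]]]; destruct Dg as [p2 [Hp2 [d2 [Hd2 H2]]]].
destruct (Cg d1 Hd1) as [d3 [Hd3 H3]].
exists (fun w => p1 (g w) * p2 w)%C; split.
{ apply ccont_mult; [now apply (ccont_comp p1 g)|exact Hp2]. }
exists (Rmin d3 d2); split; [now apply Rmin_pos|]; intros w Hw.
assert (A1 := H3 w (Rlt_le_trans _ _ _ Hw (Rmin_l _ _))).
assert (A2 := H2 w (Rlt_le_trans _ _ _ Hw (Rmin_r _ _))).
rewrite H1 by exact A1; rewrite A2; ring.
Qed.

(** Caratheodory's factor is the difference quotient, completed at [z] by the derivative. *)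
Lemma ex_derive_cdiff (f : C -> C) (z : C) :
  ex_derive (K := C_AbsRing) (V := C_NormedModule) f z -> cdiff f z.
Proof.
intros [l [_ Hl]].
specialize (Hl z (fun P H => H)).
set (phi := fun w => if excluded_middle_informative (w = z) then l
                     else ((f w - f z) / (w - z))%C).
exists phi; split.
- intros eps He.
  destruct (Hl (mkposreal (eps / 2) (is_pos_div_2 (mkposreal _ He)))) as [d Hd].
  exists d; split; [apply d|]; intros w Hw.
  unfold phi; destruct (excluded_middle_informative (z = z)) as [_|n]; [|now elim n].
  destruct (excluded_middle_informative (w = z)) as [E|n].
  { replace (l - l)%C with (RtoC 0) by ring; rewrite Cmod_0; exact He. }
  assert (Hwz : (w - z)%C <> RtoC 0).
  { intros E; apply n; replace w with ((w - z) + z)%C by ring; rewrite E; ring. }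
  assert (Q : Cmod ((f w - f z) - (w - z) * l) <= eps / 2 * Cmod (w - z)).
  { refine (Hd w _); exact Hw. }
  replace ((f w - f z) / (w - z) - l)%C
    with (((f w - f z) - (w - z) * l) / (w - z))%C by (field; exact Hwz).
  rewrite Cmod_div by exact Hwz.
  assert (P := proj1 (Cmod_gt_0 _) Hwz).
  apply Rle_lt_trans with (eps / 2); [|lra].
  apply Rle_div_l; lra.
- exists 1; split; [lra|]; intros w _; unfold phi.
  destruct (excluded_middle_informative (w = z)) as [->|n]; [ring|].
  field; intros E; apply n; replace w with ((w - z) + z)%C by ring; rewrite E; ring.
Qed.

(** * The complex exponential *)

Lemma Cexp_plus (x y : C) : Cexp (x + y) = (Cexp x * Cexp y)%C.
Proof.
unfold Cexp; destruct x as [a b]; destruct y as [c d]; unfold Cmult, Cplus; simpl.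
rewrite exp_plus, cos_plus, sin_plus; apply injective_projections; simpl; ring.
Qed.

Lemma Cexp_0 : Cexp 0 = RtoC 1.
Proof.
unfold Cexp; simpl; rewrite exp_0, cos_0, sin_0.
apply injective_projections; simpl; ring.
Qed.

Lemma Cmod_Cexp (z : C) : Cmod (Cexp z) = exp (Re z).
Proof.
unfold Cexp; rewrite Cmod_mult, Cmod_R, Rabs_pos_eq by (left; apply exp_pos).
unfold Cmod; simpl.
replace (cos (Im z) * (cos (Im z) * 1) + sin (Im z) * (sin (Im z) * 1))
  with (Rsqr (sin (Im z)) + Rsqr (cos (Im z))) by (unfold Rsqr; ring).
rewrite sin2_cos2, sqrt_1; ring.
Qed.

Lemma Cexp_neq_0 (z : C) : Cexp z <> RtoC 0.
Proof. apply Cmod_gt_0; rewrite Cmod_Cexp; apply exp_pos. Qed.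

Lemma Cexp_opp (z : C) : Cexp (- z) = (/ Cexp z)%C.
Proof.
assert (H : (Cexp (- z) * Cexp z = 1)%C).
{ rewrite <- Cexp_plus, <- Cexp_0; f_equal; ring. }
rewrite <- (Cmult_1_r (/ Cexp z)), <- H; field; apply Cexp_neq_0.
Qed.

Lemma derivable_0_bound (f : R -> R) (l : R) :
  derivable_pt_lim f 0 l -> forall eps, 0 < eps -> exists del, 0 < del /\
  forall x, Rabs x < del -> Rabs (f x - f 0 - l * x) <= eps * Rabs x.
Proof.
intros H eps He; destruct (H eps He) as [[d Hd] K]; simpl in K.
exists d; split; [exact Hd|]; intros x Hx.
destruct (Req_dec x 0) as [->|Hx0].
{ replace (f 0 - f 0 - l * 0) with 0 by ring; rewrite Rabs_R0; lra. }
specialize (K x Hx0 Hx); rewrite Rplus_0_l in K.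
replace (f x - f 0 - l * x) with (((f x - f 0) / x - l) * x) by (field; exact Hx0).
rewrite Rabs_mult; apply Rmult_le_compat_r; [apply Rabs_pos|lra].
Qed.

Lemma Cmod_le_sum (z : C) : Cmod z <= Rabs (Re z) + Rabs (Im z).
Proof.
destruct z as [x y]; simpl.
replace (x, y) with (RtoC x + Ci * RtoC y)%C
  by (apply injective_projections; simpl; ring).
eapply Rle_trans; [apply Cmod_triangle|].
rewrite Cmod_mult, Cmod_Ci, !Cmod_R; lra.
Qed.

Lemma im_le_Cmod (z : C) : Rabs (Im z) <= Cmod z.
Proof. eapply Rle_trans; [apply Rmax_r|apply Rmax_Cmod]. Qed.

Lemma Cexp_near_0 (eps : R) : 0 < eps -> exists del : R, 0 < del /\
  forall h : C, Cmod h < del -> Cmod (Cexp h - 1 - h) <= eps * Cmod h.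
Proof.
intros He.
(* With [m] the modulus of [h], the error terms below add up to at most [9 * e * m]; [m < e] turns
   the quadratic term [4 * m * m] into [4 * e * m]. *)
set (e := Rmin 1 (eps / 16)).
assert (He0 : 0 < e) by (apply Rmin_pos; lra).
assert (He1 : e <= 1) by apply Rmin_l.
assert (He2 : e <= eps / 16) by apply Rmin_r.
destruct (derivable_0_bound exp 1) with (eps := e) as [d1 [Hd1 H1]]; [|exact He0|].
{ generalize (derivable_pt_lim_exp 0); now rewrite exp_0. }
destruct (derivable_0_bound cos 0) with (eps := e) as [d2 [Hd2 H2]]; [|exact He0|].
{ generalize (derivable_pt_lim_cos 0); now rewrite sin_0, Ropp_0. }
destruct (derivable_0_bound sin 1) with (eps := e) as [d3 [Hd3 H3]]; [|exact He0|].
{ generalize (derivable_pt_lim_sin 0); now rewrite cos_0. }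
rewrite exp_0 in H1; rewrite cos_0 in H2; rewrite sin_0 in H3.
exists (Rmin (Rmin e d1) (Rmin d2 d3)); split; [apply Rmin_pos; apply Rmin_pos; assumption|].
intros h Hh.
assert (Hx := re_le_Cmod h); assert (Hy := im_le_Cmod h).
assert (L1 := Rmin_l (Rmin e d1) (Rmin d2 d3)); assert (L2 := Rmin_r (Rmin e d1) (Rmin d2 d3)).
assert (L3 := Rmin_l e d1); assert (L4 := Rmin_r e d1).
assert (L5 := Rmin_l d2 d3); assert (L6 := Rmin_r d2 d3).
destruct h as [x y]; simpl in Hx, Hy.
specialize (H1 x ltac:(lra)); specialize (H2 y ltac:(lra)); specialize (H3 y ltac:(lra)).
set (m := Cmod (x, y)) in *.
set (E := exp x - 1 - 1 * x) in *; set (K := cos y - 1 - 0 * y) in *.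
set (S := sin y - 0 - 1 * y) in *.
assert (Bx : Rabs (x + E) <= 2 * m).
{ eapply Rle_trans; [apply Rabs_triang|]; assert (Q := Rabs_pos x); nra. }
eapply Rle_trans; [apply Cmod_le_sum|].
replace (Re (Cexp (x, y) - 1 - (x, y))) with (E + (K + (x + E) * K))
  by (unfold E, K, Cexp; simpl; ring).
replace (Im (Cexp (x, y) - 1 - (x, y))) with (S + (x + E) * (y + S))
  by (unfold E, S, Cexp; simpl; ring).
assert (By : Rabs (y + S) <= 2 * m).
{ eapply Rle_trans; [apply Rabs_triang|]; assert (Q := Rabs_pos y); nra. }
assert (T1 : Rabs (E + (K + (x + E) * K)) <= Rabs E + (Rabs K + Rabs (x + E) * Rabs K)).
{ rewrite <- Rabs_mult; eapply Rle_trans; [apply Rabs_triang|].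
  apply Rplus_le_compat_l, Rabs_triang. }
assert (T2 : Rabs (S + (x + E) * (y + S)) <= Rabs S + Rabs (x + E) * Rabs (y + S)).
{ rewrite <- Rabs_mult; apply Rabs_triang. }
assert (Pm : 0 <= m) by apply Cmod_ge_0.
assert (Pe := Rabs_pos (x + E)); assert (Pk := Rabs_pos K); assert (Py := Rabs_pos (y + S)).
assert (BK : Rabs K <= e * m) by (eapply Rle_trans; [exact H2|apply Rmult_le_compat_l; lra]).
assert (BE : Rabs E <= e * m) by (eapply Rle_trans; [exact H1|apply Rmult_le_compat_l; lra]).
assert (BS : Rabs S <= e * m) by (eapply Rle_trans; [exact H3|apply Rmult_le_compat_l; lra]).
assert (M1 : Rabs (x + E) * Rabs K <= 2 * m * (e * m)) by (apply Rmult_le_compat; assumption).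
assert (M2 : Rabs (x + E) * Rabs (y + S) <= 2 * m * (2 * m)) by (apply Rmult_le_compat; assumption).
assert (Me : m < e) by lra.
assert (N1 : 2 * m * (e * m) <= 2 * (e * m)) by nra.
assert (N2 : 2 * m * (2 * m) <= 4 * (e * m)) by nra.
assert (N3 : 16 * (e * m) <= eps * m) by nra.
nra.
Qed.

(** The functional equation moves the difference quotient to 0, where it extends continuously by
    1. *)
Lemma cdiff_Cexp (z : C) : cdiff Cexp z.
Proof.
set (psi := fun h => if excluded_middle_informative (h = RtoC 0) then RtoC 1
                     else ((Cexp h - 1) / h)%C).
assert (Hpsi : ccont psi 0).
{ intros eps He; destruct (Cexp_near_0 (eps / 2)) as [d [Hd H]]; [lra|].
  exists d; split; [exact Hd|]; intros w Hw.
  replace (w - 0)%C with w in Hw by ring.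
  unfold psi; destruct (excluded_middle_informative (RtoC 0 = RtoC 0)) as [_|n]; [|now elim n].
  destruct (excluded_middle_informative (w = RtoC 0)) as [E|n].
  { replace (1 - 1)%C with (RtoC 0) by ring; rewrite Cmod_0; exact He. }
  replace ((Cexp w - 1) / w - 1)%C with ((Cexp w - 1 - w) / w)%C by (field; exact n).
  rewrite Cmod_div by exact n.
  assert (P := proj1 (Cmod_gt_0 _) n).
  apply Rle_lt_trans with (eps / 2); [|lra].
  apply Rle_div_l; [lra|now apply H]. }
exists (fun w => Cexp z * psi (w - z))%C; split.
- apply ccont_mult; [apply ccont_const|].
  apply (ccont_comp psi (fun w => w - z)%C).
  + apply ccont_plus; [apply ccont_id|apply ccont_const].
  + now replace (z - z)%C with (RtoC 0) by ring.
- exists 1; split; [lra|]; intros w _.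
  replace (Cexp w) with (Cexp z * Cexp (w - z))%C by (rewrite <- Cexp_plus; f_equal; ring).
  unfold psi; destruct (excluded_middle_informative (w - z = 0)%C) as [E|n].
  + rewrite E, Cexp_0; ring.
  + field; exact n.
Qed.

(** * Goursat's theorem *)

(* The differential form [P dx + Q dy] is differentiable at [(x, y)] with
   [dP/dy = dQ/dx] there. *)
Definition closed_at (P Q : R -> R -> R) (x y : R) : Prop :=
  exists al be ga : R, forall eps : R, 0 < eps -> exists del : R, 0 < del /\
    forall x' y' : R, Rabs (x' - x) < del -> Rabs (y' - y) < del ->
      Rabs (P x' y' - P x y - (al * (x' - x) + be * (y' - y)))
        <= eps * (Rabs (x' - x) + Rabs (y' - y)) /\
      Rabs (Q x' y' - Q x y - (be * (x' - x) + ga * (y' - y)))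
        <= eps * (Rabs (x' - x) + Rabs (y' - y)).

(* The integral of [P dx + Q dy] around the boundary of
   [[a, a + w] x [c, c + h]], opposite sides being grouped. *)
Definition circ (P Q : R -> R -> R) (a c w h : R) : R :=
  RInt (fun x => P x c - P x (c + h)) a (a + w)
  + RInt (fun y => Q (a + w) y - Q a y) c (c + h).

(** Continuity along one axis for each coefficient suffices to integrate over the sides of a
    rectangle. *)
Lemma closed_at_continuous (P Q : R -> R -> R) (x y : R) :
  closed_at P Q x y ->
  continuous (fun t => P t y) x /\ continuous (fun t => Q x t) y.
Proof.
intros (al & be & ga & H).
destruct (H 1 Rlt_0_1) as (d & Hd & K).
split; apply continuity_pt_filterlim; intros eps He.
- exists (Rmin d (eps / (Rabs al + 2))); split.
  { apply Rmin_pos; [exact Hd|]; apply Rdiv_lt_0_compat; [exact He|]; assert (T := Rabs_pos al); lra. }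
  intros t [_ Ht]; simpl in *; unfold R_dist in *.
  assert (T1 := Rlt_le_trans _ _ _ Ht (Rmin_l _ _)).
  assert (T2 := Rlt_le_trans _ _ _ Ht (Rmin_r _ _)).
  destruct (K t y T1) as [K1 _].
  { rewrite Rminus_diag, Rabs_R0; exact Hd. }
  replace (y - y) with 0 in K1 by ring; rewrite Rabs_R0, Rmult_0_r, !Rplus_0_r, Rmult_1_l in K1.
  replace (P t y - P x y) with ((P t y - P x y - al * (t - x)) + al * (t - x)) by ring.
  eapply Rle_lt_trans; [apply Rabs_triang|]; rewrite Rabs_mult.
  assert (T := Rabs_pos al); apply Rlt_div_r in T2; [|lra].
  assert (U := Rabs_pos (t - x)); nra.
- exists (Rmin d (eps / (Rabs ga + 2))); split.
  { apply Rmin_pos; [exact Hd|]; apply Rdiv_lt_0_compat; [exact He|]; assert (T := Rabs_pos ga); lra. }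
  intros t [_ Ht]; simpl in *; unfold R_dist in *.
  assert (T1 := Rlt_le_trans _ _ _ Ht (Rmin_l _ _)).
  assert (T2 := Rlt_le_trans _ _ _ Ht (Rmin_r _ _)).
  destruct (K x t) as [_ K1]; [|exact T1|].
  { rewrite Rminus_diag, Rabs_R0; exact Hd. }
  replace (x - x) with 0 in K1 by ring; rewrite Rabs_R0, Rmult_0_r, !Rplus_0_l, Rmult_1_l in K1.
  replace (Q x t - Q x y) with ((Q x t - Q x y - ga * (t - y)) + ga * (t - y)) by ring.
  eapply Rle_lt_trans; [apply Rabs_triang|]; rewrite Rabs_mult.
  assert (T := Rabs_pos ga); apply Rlt_div_r in T2; [|lra].
  assert (U := Rabs_pos (t - y)); nra.
Qed.

Definition closed_on (P Q : R -> R -> R) (a c w h : R) : Prop :=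
  forall x y, a <= x <= a + w -> c <= y <= c + h -> closed_at P Q x y.

Lemma closed_on_ex_RInt_x (P Q : R -> R -> R) (a c w h y u v : R) :
  closed_on P Q a c w h -> a <= u <= v -> v <= a + w -> c <= y <= c + h ->
  ex_RInt (fun x => P x y) u v.
Proof.
intros H Hu Hv Hy; apply (ex_RInt_continuous (V := R_CompleteNormedModule)); intros z Hz.
rewrite Rmin_left, Rmax_right in Hz by lra.
apply (closed_at_continuous P Q); apply H; lra.
Qed.

Lemma closed_on_ex_RInt_y (P Q : R -> R -> R) (a c w h x u v : R) :
  closed_on P Q a c w h -> c <= u <= v -> v <= c + h -> a <= x <= a + w ->
  ex_RInt (fun y => Q x y) u v.
Proof.
intros H Hu Hv Hy; apply (ex_RInt_continuous (V := R_CompleteNormedModule)); intros z Hz.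
rewrite Rmin_left, Rmax_right in Hz by lra.
apply (closed_at_continuous P Q); apply H; lra.
Qed.

Lemma RInt_minus_R (f g : R -> R) (a b : R) : ex_RInt f a b -> ex_RInt g a b ->
  RInt (fun x => f x - g x) a b = RInt f a b - RInt g a b.
Proof. intros; now apply (RInt_minus (V := R_CompleteNormedModule)). Qed.

Lemma RInt_Chasles_R (f : R -> R) (a b c : R) : ex_RInt f a b -> ex_RInt f b c ->
  RInt f a c = RInt f a b + RInt f b c.
Proof. intros; symmetry; now apply (RInt_Chasles (V := R_CompleteNormedModule)). Qed.

(** Splits off the main part before an estimate: the linear part in [circ_local], the limit [q] in
    [periodic_mean_bound]. *)
Lemma RInt_shift (f : R -> R) (k a b : R) : ex_RInt f a b ->
  RInt f a b = RInt (fun x => f x - k) a b + (b - a) * k.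
Proof.
intros H.
rewrite (RInt_minus_R f (fun _ => k)); [|exact H|apply (ex_RInt_const (V := R_NormedModule))].
assert (E := RInt_const (V := R_CompleteNormedModule) a b k).
change (RInt (fun _ : R => k) a b = (b - a) * k) in E; rewrite E.
generalize (RInt f a b); simpl; intros; ring.
Qed.

Lemma circ_sides (P Q : R -> R -> R) (a c w h : R) :
  0 <= w -> 0 <= h -> closed_on P Q a c w h ->
  circ P Q a c w h =
  RInt (fun x => P x c) a (a + w) - RInt (fun x => P x (c + h)) a (a + w)
  + (RInt (fun y => Q (a + w) y) c (c + h) - RInt (fun y => Q a y) c (c + h)).
Proof.
intros Hw Hh H; unfold circ.
rewrite (RInt_minus_R (fun x => P x c) (fun x => P x (c + h)))
  by (eapply closed_on_ex_RInt_x; eauto; lra).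
rewrite (RInt_minus_R (fun y => Q (a + w) y) (fun y => Q a y))
  by (eapply closed_on_ex_RInt_y; eauto; lra).
reflexivity.
Qed.

(** Each inner side is traversed twice, in opposite directions. *)
Lemma circ_split (P Q : R -> R -> R) (a c w h : R) :
  0 <= w -> 0 <= h -> closed_on P Q a c (w + w) (h + h) ->
  circ P Q a c (w + w) (h + h) =
  circ P Q a c w h + circ P Q (a + w) c w h
  + circ P Q a (c + h) w h + circ P Q (a + w) (c + h) w h.
Proof.
intros Hw Hh H.
rewrite circ_sides by (auto; lra).
rewrite !circ_sides by (auto; intros x y Hx Hy; apply H; lra).
replace (a + w + w) with (a + (w + w)) by ring.
replace (c + h + h) with (c + (h + h)) by ring.
assert (Ex : forall y u v, a <= u <= v -> v <= a + (w + w) -> c <= y <= c + (h + h) ->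
  ex_RInt (fun x => P x y) u v) by (intros; eapply closed_on_ex_RInt_x; eauto).
assert (Ey : forall x u v, c <= u <= v -> v <= c + (h + h) -> a <= x <= a + (w + w) ->
  ex_RInt (fun y => Q x y) u v) by (intros; eapply closed_on_ex_RInt_y; eauto).
rewrite (RInt_Chasles_R (fun x => P x c) a (a + w) (a + (w + w))) by (apply Ex; lra).
rewrite (RInt_Chasles_R (fun x => P x (c + (h + h))) a (a + w) (a + (w + w))) by (apply Ex; lra).
rewrite (RInt_Chasles_R (fun y => Q a y) c (c + h) (c + (h + h))) by (apply Ey; lra).
rewrite (RInt_Chasles_R (fun y => Q (a + (w + w)) y) c (c + h) (c + (h + h))) by (apply Ey; lra).
ring.
Qed.

(** The linear parts cancel: by [dP/dy = dQ/dx = be] they contribute [- be * h * w] and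
    [be * w * h]. Each of two opposite sides leaves an error of at most [eps / 2 * (w + h)],
    integrated over a length [w] or [h]. *)
Lemma circ_local (P Q : R -> R -> R) (x y eps : R) :
  closed_at P Q x y -> 0 < eps -> exists del : R, 0 < del /\
  forall a c w h : R, a <= x <= a + w -> c <= y <= c + h -> w + h < del ->
    closed_on P Q a c w h -> Rabs (circ P Q a c w h) <= eps * (w + h) ^ 2.
Proof.
intros (al & be & ga & H) He.
destruct (H (eps / 2)) as (d & Hd & K); [lra|].
exists d; split; [exact Hd|]; intros a c w h Hx Hy Hs Hcl.
assert (B : forall x' y', a <= x' <= a + w -> c <= y' <= c + h ->
   Rabs (P x' y' - P x y - (al * (x' - x) + be * (y' - y))) <= eps / 2 * (w + h) /\
   Rabs (Q x' y' - Q x y - (be * (x' - x) + ga * (y' - y))) <= eps / 2 * (w + h)).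
{ intros x' y' Hx' Hy'.
  assert (A1 : Rabs (x' - x) <= w) by (apply Rabs_le; lra).
  assert (A2 : Rabs (y' - y) <= h) by (apply Rabs_le; lra).
  destruct (K x' y') as [K1 K2]; [lra|lra|].
  split; (eapply Rle_trans; [eassumption|]; apply Rmult_le_compat_l; lra). }
assert (EP : forall y', c <= y' <= c + h -> ex_RInt (fun t => P t y') a (a + w))
  by (intros; eapply closed_on_ex_RInt_x; eauto; lra).
assert (EQ : forall x', a <= x' <= a + w -> ex_RInt (fun t => Q x' t) c (c + h))
  by (intros; eapply closed_on_ex_RInt_y; eauto; lra).
assert (EP2 : ex_RInt (fun t => P t c - P t (c + h)) a (a + w))
  by (apply (ex_RInt_minus (V := R_NormedModule)); apply EP; lra).
assert (EQ2 : ex_RInt (fun t => Q (a + w) t - Q a t) c (c + h))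
  by (apply (ex_RInt_minus (V := R_NormedModule)); apply EQ; lra).
unfold circ.
rewrite (RInt_shift (fun t => P t c - P t (c + h)) (- be * h)) by exact EP2.
rewrite (RInt_shift (fun t => Q (a + w) t - Q a t) (be * w)) by exact EQ2.
assert (B1 : Rabs (RInt (fun t => P t c - P t (c + h) - - be * h) a (a + w))
   <= (a + w - a) * (eps * (w + h))).
{ apply abs_RInt_le_const; [lra| |].
  - apply (ex_RInt_minus (V := R_NormedModule)); [|apply (ex_RInt_const (V := R_NormedModule))].
    exact EP2.
  - intros t Ht.
    destruct (B t c) as [U _]; [lra|lra|]; destruct (B t (c + h)) as [V _]; [lra|lra|].
    apply Rabs_le_between in U; apply Rabs_le_between in V; apply Rabs_le; nra. }
assert (B2 : Rabs (RInt (fun t => Q (a + w) t - Q a t - be * w) c (c + h))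
   <= (c + h - c) * (eps * (w + h))).
{ apply abs_RInt_le_const; [lra| |].
  - apply (ex_RInt_minus (V := R_NormedModule)); [|apply (ex_RInt_const (V := R_NormedModule))].
    exact EQ2.
  - intros t Ht.
    destruct (B a t) as [_ U]; [lra|lra|]; destruct (B (a + w) t) as [_ V]; [lra|lra|].
    apply Rabs_le_between in U; apply Rabs_le_between in V; apply Rabs_le; nra. }
match goal with |- Rabs (?x + ?u + (?y + ?v)) <= _ =>
  replace (x + u + (y + v)) with (x + y) by ring end.
eapply Rle_trans; [apply Rabs_triang|]; lra.
Qed.

Section Bisection.

Variables (P Q : R -> R -> R) (w h eps : R).

(** The threshold scales like an area, so four quadrants that respect it make the whole rectangle
    respect it: a bad rectangle has a bad quadrant. *)
Definition bad (n : nat) (q : R * R) : Prop :=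
  eps * (w / 2 ^ n + h / 2 ^ n) ^ 2
    < Rabs (circ P Q (fst q) (snd q) (w / 2 ^ n) (h / 2 ^ n)).

(** The last quadrant is the default and is not tested; [quadrant_bad] shows that it is bad when the
    others are not. *)
Definition quadrant (n : nat) (q : R * R) : R * R :=
  let w' := w / 2 ^ S n in let h' := h / 2 ^ S n in
  if excluded_middle_informative (bad (S n) q) then q
  else if excluded_middle_informative (bad (S n) (fst q + w', snd q)) then (fst q + w', snd q)
  else if excluded_middle_informative (bad (S n) (fst q, snd q + h')) then (fst q, snd q + h')
  else (fst q + w', snd q + h').

Fixpoint corner (q : R * R) (n : nat) : R * R :=
  match n with O => q | S n => quadrant n (corner q n) end.

Lemma halve (t : R) (n : nat) : t / 2 ^ n = t / 2 ^ S n + t / 2 ^ S n.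
Proof. simpl; field; apply pow_nonzero; lra. Qed.

Hypotheses (Hw : 0 <= w) (Hh : 0 <= h).

Lemma halved_pos (t : R) (n : nat) : 0 <= t -> 0 <= t / 2 ^ n.
Proof. intros Ht; apply Rdiv_le_0_compat; [exact Ht|apply pow_lt; lra]. Qed.

Lemma quadrant_inside (n : nat) (q : R * R) :
  fst q <= fst (quadrant n q) <= fst q + w / 2 ^ S n /\
  snd q <= snd (quadrant n q) <= snd q + h / 2 ^ S n.
Proof.
assert (A := halved_pos w (S n) Hw); assert (B := halved_pos h (S n) Hh).
unfold quadrant; repeat destruct excluded_middle_informative; cbn [fst snd]; lra.
Qed.

Lemma quadrant_bad (n : nat) (q : R * R) :
  closed_on P Q (fst q) (snd q) (w / 2 ^ n) (h / 2 ^ n) ->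
  bad n q -> bad (S n) (quadrant n q).
Proof.
intros H Hb.
unfold quadrant.
destruct excluded_middle_informative as [b|n1]; [exact b|].
destruct excluded_middle_informative as [b|n2]; [exact b|].
destruct excluded_middle_informative as [b|n3]; [exact b|].
destruct (excluded_middle_informative (bad (S n) (fst q + w / 2 ^ S n, snd q + h / 2 ^ S n)))
  as [b|n4]; [exact b|].
exfalso; revert H Hb n1 n2 n3 n4; unfold bad.
rewrite (halve w n), (halve h n).
assert (A := halved_pos w (S n) Hw); assert (B := halved_pos h (S n) Hh).
set (w' := w / 2 ^ S n) in *; set (h' := h / 2 ^ S n) in *.
intros H Hb n1 n2 n3 n4; cbn [fst snd] in *.
rewrite circ_split in Hb by assumption.
apply Rnot_lt_le in n1; apply Rnot_lt_le in n2; apply Rnot_lt_le in n3; apply Rnot_lt_le in n4.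
revert Hb; apply Rle_not_lt.
eapply Rle_trans; [apply Rabs_triang|].
eapply Rle_trans; [apply Rplus_le_compat_r, Rabs_triang|].
eapply Rle_trans; [apply Rplus_le_compat_r, Rplus_le_compat_r, Rabs_triang|].
nra.
Qed.

Lemma corner_nested (q : R * R) (n k : nat) :
  fst (corner q n) <= fst (corner q (n + k)) <= fst (corner q n) + w / 2 ^ n - w / 2 ^ (n + k) /\
  snd (corner q n) <= snd (corner q (n + k)) <= snd (corner q n) + h / 2 ^ n - h / 2 ^ (n + k).
Proof.
induction k as [|k IH].
- rewrite Nat.add_0_r; lra.
- rewrite Nat.add_succ_r; simpl corner.
  assert (I := quadrant_inside (n + k) (corner q (n + k))).
  assert (E1 := halve w (n + k)); assert (E2 := halve h (n + k)); lra.
Qed.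

Lemma corner_closed (q : R * R) (n : nat) :
  closed_on P Q (fst q) (snd q) w h ->
  closed_on P Q (fst (corner q n)) (snd (corner q n)) (w / 2 ^ n) (h / 2 ^ n).
Proof.
intros H x y Hx Hy; assert (I := corner_nested q 0 n); simpl in I.
apply H; lra.
Qed.

Lemma corner_bad (q : R * R) (n : nat) :
  closed_on P Q (fst q) (snd q) w h -> bad 0 q -> bad n (corner q n).
Proof.
intros H H0; induction n as [|n IH]; [exact H0|].
apply quadrant_bad; [now apply corner_closed|exact IH].
Qed.

End Bisection.

Lemma nested_limit (u : nat -> R) (w : R) :
  (forall n k, u n <= u (n + k)%nat <= u n + w / 2 ^ n) ->
  exists x, forall n, u n <= x <= u n + w / 2 ^ n.
Proof.
intros H.
destruct (completeness (fun z => exists n, z = u n)) as [x [Hub Hlub]].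
- exists (u 0%nat + w / 2 ^ 0); intros z [n ->]; exact (proj2 (H 0%nat n)).
- exists (u 0%nat); now exists 0%nat.
- exists x; intros n; split; [apply Hub; now exists n|].
  apply Hlub; intros z [k ->].
  destruct (le_lt_dec n k) as [L|L].
  + replace k with (n + (k - n))%nat by lia; apply H.
  + eapply Rle_trans; [|exact (Rle_trans _ _ _ (proj1 (H n 0%nat)) (proj2 (H n 0%nat)))].
    replace n with (k + (n - k))%nat by lia; apply H.
Qed.

(** A nonzero integral makes the rectangle bad for some [eps]; nested bad quadrants then shrink to a
    point at which [circ_local] is violated. *)
Theorem goursat (P Q : R -> R -> R) (a c w h : R) :
  0 <= w -> 0 <= h -> closed_on P Q a c w h -> circ P Q a c w h = 0.
Proof.
intros Hw Hh H.
assert (Main : forall eps, 0 < eps -> ~ bad P Q w h eps 0 (a, c)).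
{ intros eps He Hb.
  set (q := corner P Q w h eps (a, c)).
  assert (Nest : forall n k, _) by exact (corner_nested P Q w h eps Hw Hh (a, c)).
  fold q in Nest.
  assert (Pw : forall n, 0 <= w / 2 ^ n) by (intros; now apply halved_pos).
  assert (Ph : forall n, 0 <= h / 2 ^ n) by (intros; now apply halved_pos).
  destruct (nested_limit (fun n => fst (q n)) w) as [x Hx].
  { intros n k; specialize (Nest n k); specialize (Pw (n + k)%nat); lra. }
  destruct (nested_limit (fun n => snd (q n)) h) as [y Hy].
  { intros n k; specialize (Nest n k); specialize (Ph (n + k)%nat); lra. }
  destruct (circ_local P Q x y eps) as (d & Hd & K); [|exact He|].
  { apply H; [specialize (Hx 0%nat)|specialize (Hy 0%nat)]; simpl in *; lra. }
  destruct (pow_lt_1_zero (/ 2)) with (y := d / (w + h + 1)) as [N HN].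
  { rewrite Rabs_pos_eq; lra. }
  { apply Rdiv_lt_0_compat; lra. }
  specialize (HN N (le_n N)).
  rewrite Rabs_pos_eq, pow_inv in HN by (apply pow_le; lra).
  apply (Rlt_irrefl (eps * (w / 2 ^ N + h / 2 ^ N) ^ 2)).
  eapply Rlt_le_trans; [exact (corner_bad P Q w h eps Hw Hh (a, c) N H Hb)|].
  apply K; [apply Hx|apply Hy| |now apply corner_closed].
  apply Rlt_div_r in HN; [|lra].
  assert (0 < / 2 ^ N) by (apply Rinv_0_lt_compat, pow_lt; lra).
  unfold Rdiv; nra. }
destruct (Req_dec (circ P Q a c w h) 0) as [E|E]; [exact E|exfalso].
assert (Pos := Rabs_pos_lt _ E).
set (m := Rabs (circ P Q a c w h)) in *.
(* This puts the threshold of the whole rectangle below [m]; the [+ 1] covers the degenerate case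
   [w + h = 0]. *)
apply (Main (m / (2 * ((w + h) ^ 2 + 1)))).
- apply Rdiv_lt_0_compat; nra.
- unfold bad; rewrite !pow_O, !Rdiv_1_r; cbn [fst snd]; fold m.
  assert (A : 0 <= (w + h) ^ 2) by apply pow2_ge_0.
  replace (m / (2 * ((w + h) ^ 2 + 1)) * (w + h) ^ 2)
    with (m * ((w + h) ^ 2 / (2 * ((w + h) ^ 2 + 1)))) by (field; lra).
  rewrite <- (Rmult_1_r m) at 2; apply Rmult_lt_compat_l; [exact Pos|].
  apply Rlt_div_l; lra.
Qed.

(** * Uniqueness of continuation *)

(** These are the imaginary and the real part of the form [f dz]. By the Cauchy-Riemann equations
    the common mixed derivative is [Re l] for the first and [- Im l] for the second, with [l] the
    complex derivative. *)
Lemma cdiff_closed_at (f : C -> C) (x y : R) : cdiff f (x, y) ->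
  closed_at (fun s t => Im (f (s, t))) (fun s t => Re (f (s, t))) x y /\
  closed_at (fun s t => Re (f (s, t))) (fun s t => - Im (f (s, t))) x y.
Proof.
intros [phi [Hphi [d [Hd H]]]].
set (l := phi (x, y)).
assert (K : forall eps, 0 < eps -> exists del, 0 < del /\ forall x' y',
  Rabs (x' - x) < del -> Rabs (y' - y) < del ->
  Cmod (f (x', y') - f (x, y) - l * ((x', y') - (x, y)))%C
     <= eps * (Rabs (x' - x) + Rabs (y' - y))).
{ intros eps He; destruct (Hphi eps He) as [d2 [Hd2 H2]].
  exists (Rmin d d2 / 2); split.
  { assert (0 < Rmin d d2) by now apply Rmin_pos. lra. }
  intros x' y' Hx Hy.
  assert (S : Cmod ((x', y') - (x, y))%C <= Rabs (x' - x) + Rabs (y' - y))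
    by exact (Cmod_le_sum ((x', y') - (x, y))%C).
  assert (L1 := Rmin_l d d2); assert (L2 := Rmin_r d d2).
  rewrite H by lra.
  replace (phi (x', y') * ((x', y') - (x, y)) - l * ((x', y') - (x, y)))%C
    with ((phi (x', y') - l) * ((x', y') - (x, y)))%C by ring.
  rewrite Cmod_mult.
  apply Rmult_le_compat; [apply Cmod_ge_0|apply Cmod_ge_0| |exact S].
  left; apply H2; lra. }
assert (KR : forall eps, 0 < eps -> exists del, 0 < del /\ forall x' y',
  Rabs (x' - x) < del -> Rabs (y' - y) < del ->
  Rabs (Re (f (x', y')) - Re (f (x, y)) - (Re l * (x' - x) + - Im l * (y' - y)))
     <= eps * (Rabs (x' - x) + Rabs (y' - y)) /\
  Rabs (Im (f (x', y')) - Im (f (x, y)) - (Im l * (x' - x) + Re l * (y' - y)))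
     <= eps * (Rabs (x' - x) + Rabs (y' - y))).
{ intros eps He; destruct (K eps He) as [del [Hdel Q]].
  exists del; split; [exact Hdel|]; intros x' y' Hx Hy.
  specialize (Q x' y' Hx Hy).
  split; (eapply Rle_trans; [|exact Q]).
  - eapply Rle_trans; [|apply re_le_Cmod].
    right; f_equal; simpl; unfold Re, Im; ring.
  - eapply Rle_trans; [|apply im_le_Cmod].
    right; f_equal; simpl; unfold Re, Im; ring. }
split.
- exists (Im l), (Re l), (- Im l); intros eps He.
  destruct (KR eps He) as [del [Hdel Q]]; exists del; split; [exact Hdel|].
  intros x' y' Hx Hy; destruct (Q x' y' Hx Hy); split; assumption.
- exists (Re l), (- Im l), (- Re l); intros eps He.
  destruct (KR eps He) as [del [Hdel Q]]; exists del; split; [exact Hdel|].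
  intros x' y' Hx Hy; destruct (Q x' y' Hx Hy) as [Q1 Q2]; split; [assumption|].
  rewrite <- Rabs_Ropp; eapply Rle_trans; [|exact Q2]; right; f_equal; ring.
Qed.

(** On a rectangle of height [2 * PI] the horizontal sides cancel by periodicity, so the integrals
    of [Q] over the two vertical sides agree. The right one is at most [2 * PI * M] in absolute
    value, the left one is close to [2 * PI * q]. Arguing with a bound for every [eps] avoids
    passing to the limit under the integral. *)
Lemma periodic_mean_bound (P Q : R -> R -> R) (x1 M q : R) :
  (forall x y, x <= x1 -> closed_at P Q x y) ->
  (forall x, P x (0 + 2 * PI) = P x 0) ->
  (forall y, 0 <= y <= 2 * PI -> Rabs (Q x1 y) <= M) ->
  (forall eps, 0 < eps -> exists x0, x0 <= x1 /\ forall y, Rabs (Q x0 y - q) <= eps) ->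
  Rabs q <= M.
Proof.
intros Hcl Hper HM Hlim.
assert (Ppi := PI_RGT_0).
apply le_epsilon; intros eps He.
destruct (Hlim eps He) as [x0 [Hx0 H0]].
assert (Cl : closed_on P Q x0 0 (x1 - x0) (2 * PI)).
{ intros x y Hx Hy; apply Hcl; lra. }
assert (G := goursat P Q x0 0 (x1 - x0) (2 * PI) ltac:(lra) ltac:(lra) Cl).
assert (Ex : ex_RInt (fun y => Q (x0 + (x1 - x0)) y - Q x0 y) 0 (0 + 2 * PI)).
{ apply (ex_RInt_minus (V := R_NormedModule)); eapply closed_on_ex_RInt_y; eauto; lra. }
unfold circ in G.
rewrite (RInt_ext (V := R_CompleteNormedModule) _ (fun _ => 0)) in G
  by (intros x _; rewrite Hper; apply Rminus_diag).
assert (E := RInt_const (V := R_CompleteNormedModule) x0 (x0 + (x1 - x0)) 0).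
change (RInt (fun _ : R => 0) x0 (x0 + (x1 - x0)) = (x0 + (x1 - x0) - x0) * 0) in E.
rewrite E, Rmult_0_r, Rplus_0_l in G.
rewrite (RInt_shift _ (- q) _ _ Ex) in G.
assert (B : Rabs (RInt (fun y => Q (x0 + (x1 - x0)) y - Q x0 y - - q) 0 (0 + 2 * PI))
   <= (0 + 2 * PI - 0) * (M + eps)).
{ apply abs_RInt_le_const; [lra| |].
  - apply (ex_RInt_minus (V := R_NormedModule)); [exact Ex|apply (ex_RInt_const (V := R_NormedModule))].
  - intros y Hy.
    replace (Q (x0 + (x1 - x0)) y - Q x0 y - - q)
      with (Q x1 y + - (Q x0 y - q)) by (replace (x0 + (x1 - x0)) with x1 by ring; ring).
    eapply Rle_trans; [apply Rabs_triang|]; rewrite Rabs_Ropp.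
    apply Rplus_le_compat; [apply HM; lra|apply H0]. }
apply Rmult_le_reg_l with (2 * PI); [lra|].
replace (2 * PI * Rabs q) with (Rabs ((0 + 2 * PI - 0) * q)).
2:{ rewrite Rabs_mult, (Rabs_pos_eq (0 + 2 * PI - 0)) by lra; f_equal; ring. }
match type of G with ?I + _ = 0 =>
  replace ((0 + 2 * PI - 0) * q) with I by (clear - G; lra) end.
eapply Rle_trans; [exact B|]; lra.
Qed.

Lemma Cexp_period (x y : R) : Cexp (x, y + 2 * PI) = Cexp (x, y).
Proof. unfold Cexp; cbn [Re Im fst snd].
rewrite cos_plus, sin_plus, cos_2PI, sin_2PI.
apply injective_projections; simpl; ring. Qed.

Lemma exp_le_compat (x y : R) : x <= y -> exp x <= exp y.
Proof. intros [H| ->]; [left; now apply exp_increasing|right; reflexivity]. Qed.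

(* The mean value property at the centre is Goursat's theorem in the
   coordinate [w], [z = a + exp w], on a long rectangle of height [2 PI]. *)
Lemma cdiff_max_bound (H : C -> C) (a : C) (r M : R) : 0 < r ->
  (forall z, Cmod (z - a) <= r -> cdiff H z) ->
  (forall th, 0 <= th <= 2 * PI -> Cmod (H (a + Cexp (ln r, th))%C) <= M) ->
  Cmod (H a) <= 2 * M.
Proof.
intros Hr Hd HM.
set (g := fun w => H (a + Cexp w)%C).
assert (Dg : forall x y, x <= ln r -> cdiff g (x, y)).
{ intros x y Hx; apply (cdiff_comp H (fun w => a + Cexp w)%C).
  - apply cdiff_plus; [apply cdiff_const|apply cdiff_Cexp].
  - apply Hd; replace (a + Cexp (x, y) - a)%C with (Cexp (x, y)) by ring.
    rewrite Cmod_Cexp; simpl; rewrite <- (exp_ln r Hr).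
    now apply exp_le_compat. }
assert (Lim : forall eps, 0 < eps -> exists x0, x0 <= ln r /\
   forall y, Cmod (g (x0, y) - H a) <= eps).
{ intros eps He.
  assert (Ca : ccont H a).
  { apply cdiff_ccont, Hd; replace (a - a)%C with (RtoC 0) by ring; rewrite Cmod_0; lra. }
  destruct (Ca eps He) as [d [Hd0 K]].
  set (e := Rmin r (d / 2)).
  assert (He0 : 0 < e) by (apply Rmin_pos; lra).
  exists (ln e); split.
  { destruct (Rmin_l r (d / 2)) as [L|L]; [left; now apply ln_increasing|right].
    unfold e; now rewrite L. }
  intros y; left; apply K.
  replace (a + Cexp (ln e, y) - a)%C with (Cexp (ln e, y)) by ring.
  rewrite Cmod_Cexp; simpl; rewrite exp_ln by exact He0.
  unfold e; assert (L := Rmin_r r (d / 2)); lra. }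
assert (Per : forall x, g (x, 0 + 2 * PI) = g (x, 0)).
{ intros x; unfold g; now rewrite Cexp_period. }
(* Real and imaginary part are bounded separately, hence the factor 2. It is harmless in
   [vanish_step], where [M] can be made small. *)
assert (BR : Rabs (Re (H a)) <= M).
{ apply (periodic_mean_bound (fun s t => Im (g (s, t))) (fun s t => Re (g (s, t))) (ln r)).
  - intros x y Hx; exact (proj1 (cdiff_closed_at g x y (Dg x y Hx))).
  - intros x; now rewrite Per.
  - intros y Hy; eapply Rle_trans; [apply re_le_Cmod|now apply HM].
  - intros eps He; destruct (Lim eps He) as [x0 [Hx0 K]].
    exists x0; split; [exact Hx0|]; intros y.
    eapply Rle_trans; [|apply (K y)].
    exact (re_le_Cmod (g (x0, y) - H a)%C). }
assert (BI : Rabs (- Im (H a)) <= M).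
{ apply (periodic_mean_bound (fun s t => Re (g (s, t))) (fun s t => - Im (g (s, t))) (ln r)).
  - intros x y Hx; exact (proj2 (cdiff_closed_at g x y (Dg x y Hx))).
  - intros x; now rewrite Per.
  - intros y Hy; rewrite Rabs_Ropp; eapply Rle_trans; [apply im_le_Cmod|now apply HM].
  - intros eps He; destruct (Lim eps He) as [x0 [Hx0 K]].
    exists x0; split; [exact Hx0|]; intros y.
    eapply Rle_trans; [|apply (K y)].
    replace (- Im (g (x0, y)) - - Im (H a)) with (- (Im (g (x0, y)) - Im (H a))) by ring.
    rewrite Rabs_Ropp.
    exact (im_le_Cmod (g (x0, y) - H a)%C). }
rewrite Rabs_Ropp in BI.
eapply Rle_trans; [apply Cmod_le_sum|]; lra.
Qed.

(* Uniqueness of continuation is proved for uniform limits of holomorphic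
   functions, so that Weierstrass' theorem on their differentiability is not needed. *)
Definition approx (F : C -> C) (S : C -> Prop) : Prop :=
  forall eps : R, 0 < eps -> exists G : C -> C,
    forall z : C, S z -> cdiff G z /\ Cmod (G z - F z) <= eps.

Lemma circle_bounded (G : C -> C) (a : C) (r : R) : 0 < r ->
  (forall z, Cmod (z - a) = r -> ccont G z) ->
  exists B, 0 <= B /\ forall th, 0 <= th <= 2 * PI ->
    Cmod (G (a + Cexp (ln r, th))%C) <= B.
Proof.
intros Hr HG.
assert (Ppi := PI_RGT_0).
destruct (continuity_ab_maj (fun th => Cmod (G (a + Cexp (ln r, th))%C)) 0 (2 * PI))
  as [m [Hm _]]; [lra| |].
- intros c _ eps He.
  set (g := fun w => G (a + Cexp w)%C).
  assert (Cg : ccont g (ln r, c)).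
  { apply (ccont_comp G (fun w => a + Cexp w)%C).
    - apply cdiff_ccont, cdiff_plus; [apply cdiff_const|apply cdiff_Cexp].
    - apply HG; replace (a + Cexp (ln r, c) - a)%C with (Cexp (ln r, c)) by ring.
      rewrite Cmod_Cexp; simpl; now apply exp_ln. }
  destruct (Cg eps He) as [d [Hd K]].
  exists d; split; [exact Hd|]; intros t [_ Ht]; simpl in *; unfold R_dist in *.
  assert (Q : Cmod (g (ln r, t) - g (ln r, c)) < eps).
  { apply K; eapply Rle_lt_trans; [apply Cmod_le_sum|]; simpl.
    replace (ln r + - ln r) with 0 by ring; rewrite Rabs_R0, Rplus_0_l; exact Ht. }
  fold (g (ln r, t)); fold (g (ln r, c)).
  assert (A1 := Cmod_triangle_minus (g (ln r, t)) (g (ln r, c))).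
  assert (A2 := Cmod_triangle_minus (g (ln r, c)) (g (ln r, t))).
  rewrite Cmod_minus_sym in A2.
  apply Rabs_def1; lra.
- exists (Cmod (G (a + Cexp (ln r, m))%C)); split; [apply Cmod_ge_0|exact Hm].
Qed.

(** An entire function equal to 1 at [a]. On the circle the logarithm of its modulus is
    [k * r * (c^2 - c - 1/2)] with [c = cos th]. The linear term alone changes sign at [c = 0]; the
    quadratic term moves the change to the left of [c = - 1/4], where the value is [- 3/16]. That
    margin lets a half-plane of zeros advance by [r / 4] in each step. *)
Definition weight (a : C) (r k : R) (z : C) : C :=
  Cexp (RtoC k * (- (z - a) + RtoC (/ (2 * r)) * ((z - a) * (z - a))))%C.

Lemma cdiff_weight (a : C) (r k : R) (z : C) : cdiff (weight a r k) z.
Proof.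
unfold weight.
apply (cdiff_comp Cexp (fun z => RtoC k * (- (z - a) + RtoC (/ (2 * r)) * ((z - a) * (z - a))))%C);
  [|apply cdiff_Cexp].
assert (D : cdiff (fun z => z - a)%C z).
{ apply (cdiff_minus (fun z => z) (fun _ => a)); [apply cdiff_id|apply cdiff_const]. }
apply cdiff_mult; [apply cdiff_const|].
apply cdiff_plus; [now apply cdiff_opp|].
apply cdiff_mult; [apply cdiff_const|now apply cdiff_mult].
Qed.

Lemma weight_center (a : C) (r k : R) : weight a r k a = RtoC 1.
Proof.
unfold weight; rewrite <- Cexp_0; f_equal; ring.
Qed.

Lemma Cmod_weight_circle (a : C) (r k th : R) : 0 < r ->
  Cmod (weight a r k (a + Cexp (ln r, th))%C)
  = exp (k * r * ((cos th) ^ 2 - cos th - / 2)).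
Proof.
intros Hr; unfold weight; rewrite Cmod_Cexp; f_equal.
replace (a + Cexp (ln r, th) - a)%C with (Cexp (ln r, th)) by ring.
unfold Cexp; simpl; rewrite exp_ln by exact Hr.
assert (T := sin2_cos2 th); unfold Rsqr in T.
replace (sin th * sin th) with (1 - cos th * cos th) by lra.
field_simplify_eq; [|lra].
replace (sin th ^ 2) with (1 - cos th * cos th) by (simpl; lra); ring.
Qed.

Lemma vanish_step (F : C -> C) (a : C) (r : R) : 0 < r ->
  approx F (fun z => Cmod (z - a) <= r) ->
  (forall z, Cmod (z - a) = r -> Re z <= Re a - r / 4 -> F z = RtoC 0) ->
  F a = RtoC 0.
Proof.
intros Hr Happ Hz.
assert (Ha : Cmod (a - a) <= r).
{ replace (a - a)%C with (RtoC 0) by ring; rewrite Cmod_0; lra. }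
assert (Circ : forall th, Cmod (a + Cexp (ln r, th) - a)%C = r).
{ intros th; replace (a + Cexp (ln r, th) - a)%C with (Cexp (ln r, th)) by ring.
  rewrite Cmod_Cexp; simpl; now apply exp_ln. }
(* As [F] is only given as a limit, its bound on the circle is that of an approximant within 1 of
   it. *)
assert (HB : exists B, 0 <= B /\ forall th, 0 <= th <= 2 * PI ->
   Cmod (F (a + Cexp (ln r, th))%C) <= B).
{ destruct (Happ 1 Rlt_0_1) as [G HG].
  destruct (circle_bounded G a r Hr) as [B [HB0 HB]].
  { intros z Hz1; apply cdiff_ccont, HG; lra. }
  exists (B + 1); split; [lra|]; intros th Hth.
  specialize (HB th Hth).
  assert (HG1 := proj2 (HG (a + Cexp (ln r, th))%C (Req_le _ _ (Circ th)))).
  assert (A := Cmod_triangle_minus (F (a + Cexp (ln r, th))%C) (G (a + Cexp (ln r, th))%C)).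
  rewrite Cmod_minus_sym in A; lra. }
destruct HB as [B [HB0 HB]].
apply Cmod_eq_0.
assert (P0 := Cmod_ge_0 (F a)).
destruct P0 as [P0|P0]; [exfalso|now symmetry].
(* At the end [G a] is at most [eta] in modulus and within [eta] of [F a], which leaves [F a] at
   most [2 * eta], a contradiction. *)
set (eta := Cmod (F a) / 3) in *.
assert (He : 0 < eta) by (unfold eta; lra).
(* The weight has modulus 1 at [a] and at most [exp (- 3 k r / 16)] on the part of
   the circle where [F] may be nonzero; on the rest [F = 0] absorbs its growth. *)
assert (Hk : exists k, 0 <= k /\ 2 * ((B + 1) * exp (- (k * r * (3 / 16)))) <= eta).
(* With [2 * (B + 1) = eta * t] the claim becomes [t <= exp t]. *)
{ set (t := 2 * (B + 1) / eta).
  assert (Ht : 0 < t) by (apply Rdiv_lt_0_compat; lra).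
  exists (16 * t / (3 * r)); split.
  { apply Rdiv_le_0_compat; lra. }
  replace (16 * t / (3 * r) * r * (3 / 16)) with t by (field; lra).
  rewrite exp_Ropp.
  assert (E := exp_ineq1 t ltac:(lra)).
  apply Rmult_le_reg_r with (exp t); [apply exp_pos|].
  replace (2 * ((B + 1) * / exp t) * exp t) with (eta * t).
  - apply Rmult_le_compat_l; lra.
  - unfold t; field; split; [apply Rgt_not_eq, exp_pos|lra]. }
destruct Hk as [k [Hk0 Hk]].
(* [3 / 2] is the maximum of [c^2 - c - 1/2] on the vanishing arc, taken at [c = -1]. The accuracy
   [eps] is fixed after [k], so that it can outweigh [W]. *)
set (W := exp (k * r * (3 / 2))).
assert (HW : 0 < W) by apply exp_pos.
set (eps := Rmin 1 (Rmin eta (eta / (2 * W)))).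
assert (Heps : 0 < eps).
{ apply Rmin_pos; [lra|apply Rmin_pos; [lra|apply Rdiv_lt_0_compat; lra]]. }
assert (E1 : eps <= 1) by apply Rmin_l.
assert (E2 : eps <= eta) by (eapply Rle_trans; [apply Rmin_r|apply Rmin_l]).
assert (E3 : 2 * (eps * W) <= eta).
{ assert (Q : eps <= eta / (2 * W)) by (eapply Rle_trans; [apply Rmin_r|apply Rmin_r]).
  apply Rle_div_r in Q; lra. }
destruct (Happ eps Heps) as [G HG].
assert (MB : Cmod (G a * weight a r k a)%C <= 2 * (eta / 2)).
{ apply (cdiff_max_bound (fun z => G z * weight a r k z)%C a r); [exact Hr| |].
  - intros z Hz1; apply cdiff_mult; [now apply HG|apply cdiff_weight].
  - intros th Hth.
    rewrite Cmod_mult, Cmod_weight_circle by exact Hr.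
    assert (HG1 := proj2 (HG (a + Cexp (ln r, th))%C (Req_le _ _ (Circ th)))).
    set (z := (a + Cexp (ln r, th))%C) in *.
    assert (A := Cmod_triangle_minus (G z) (F z)).
    assert (Cb := COS_bound th).
    assert (Hkr : 0 <= k * r) by (apply Rmult_le_pos; lra).
    destruct (Rle_lt_dec (cos th) (- / 4)) as [L|L].
    + assert (F0 : F z = RtoC 0).
      { apply Hz; [apply Circ|]; unfold z, Cexp; simpl; rewrite exp_ln by exact Hr; unfold Re; nra. }
      rewrite F0, Cmod_0 in A.
      assert (X : exp (k * r * (cos th ^ 2 - cos th - / 2)) <= W).
      { unfold W; apply exp_le_compat, Rmult_le_compat_l; nra. }
      assert (Y := exp_pos (k * r * (cos th ^ 2 - cos th - / 2))).
      rewrite F0 in HG1.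
      apply Rle_trans with (eps * W); [|lra].
      apply Rmult_le_compat; [apply Cmod_ge_0|lra|lra|exact X].
    + assert (X : exp (k * r * (cos th ^ 2 - cos th - / 2)) <= exp (- (k * r * (3 / 16)))).
      { apply exp_le_compat; replace (- (k * r * (3 / 16))) with (k * r * (- (3 / 16))) by ring.
        apply Rmult_le_compat_l; nra. }
      assert (Y := exp_pos (k * r * (cos th ^ 2 - cos th - / 2))).
      specialize (HB th Hth); fold z in HB.
      apply Rle_trans with ((B + 1) * exp (- (k * r * (3 / 16)))); [|lra].
      apply Rmult_le_compat; [apply Cmod_ge_0|lra|lra|exact X]. }
rewrite weight_center, Cmult_1_r in MB.
destruct (HG a Ha) as [_ HGa].
assert (A := Cmod_triangle_minus (F a) (G a)); rewrite Cmod_minus_sym in A.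
unfold eta in *; lra.
Qed.

Lemma Cexp_surj (w : C) : w <> RtoC 0 -> exists t : R, Cexp (ln (Cmod w), t) = w.
Proof.
intros Hw; assert (Hm := proj1 (Cmod_gt_0 w) Hw).
set (m := Cmod w) in *.
destruct w as [x y].
assert (Q : x ^ 2 + y ^ 2 = m ^ 2).
{ unfold m; rewrite Cmod2_alt; reflexivity. }
set (c := x / m).
assert (Ec : x = m * c) by (unfold c; field; lra).
assert (Ey : y ^ 2 = m ^ 2 * (1 - c ^ 2)) by (rewrite Ec in Q; nra).
assert (Hc : 0 <= 1 - c ^ 2).
{ apply Rmult_le_reg_l with (m ^ 2); [nra|]; rewrite <- Ey, Rmult_0_r; nra. }
assert (Hc2 : -1 <= c <= 1) by nra.
assert (Cc := cos_acos c Hc2); assert (Sc := sin_acos c Hc2).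
assert (Ys : Rabs y = m * sqrt (1 - Rsqr c)).
{ replace (1 - Rsqr c) with (1 - c ^ 2) by (unfold Rsqr; ring).
  rewrite <- sqrt_Rsqr_abs.
  replace (Rsqr y) with (Rsqr m * (1 - c ^ 2)) by (unfold Rsqr; simpl in *; lra).
  rewrite sqrt_mult, sqrt_Rsqr by (try lra; apply Rle_0_sqr); reflexivity. }
destruct (Rle_lt_dec 0 y) as [L|L].
- exists (acos c); unfold Cexp; cbn [Re Im fst snd].
  rewrite exp_ln, Cc, Sc by exact Hm; rewrite Rabs_pos_eq in Ys by exact L.
  apply injective_projections; simpl; lra.
- exists (- acos c); unfold Cexp; cbn [Re Im fst snd].
  rewrite exp_ln, cos_neg, sin_neg, Cc, Sc by exact Hm.
  rewrite Rabs_left in Ys by exact L.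
  apply injective_projections; simpl; lra.
Qed.

(** In the coordinate [w] with [z = c + exp w] the punctured disc is the half-plane [Re w < ln R],
    and the known zeros fill [Re w <= ln rho]. The radius [r] is half the logarithmic distance from
    [z] to the rim, so the same [r] serves every step and finitely many gains of [r / 4] reach [z].
    The centre itself has no logarithm and is treated apart. *)
Lemma vanish_disc (F : C -> C) (c : C) (R rho : R) : 0 < rho -> 0 < R ->
  approx F (fun z => Cmod (z - c) < R) ->
  (forall z, Cmod (z - c) <= rho -> F z = RtoC 0) ->
  forall z, Cmod (z - c) < R -> F z = RtoC 0.
Proof.
intros Hrho HR Happ Hz z Hzr.
destruct (excluded_middle_informative (z = c)) as [->|Hne].
{ apply Hz; replace (c - c)%C with (RtoC 0) by ring; rewrite Cmod_0; lra. }
assert (Hne' : (z - c)%C <> RtoC 0).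
{ intros E; apply Hne; replace z with ((z - c) + c)%C by ring; rewrite E; ring. }
assert (Hm := proj1 (Cmod_gt_0 _) Hne').
destruct (Cexp_surj (z - c)%C Hne') as [t Ht].
set (m := Cmod (z - c)) in *.
assert (Hln : ln m < ln R) by now apply ln_increasing.
set (r := (ln R - ln m) / 2).
assert (Hr : 0 < r) by (unfold r; lra).
set (g := fun w => F (c + Cexp w)%C).
assert (Inside : forall w, Re w < ln R -> Cmod (c + Cexp w - c) < R).
{ intros w Hw; replace (c + Cexp w - c)%C with (Cexp w) by ring.
  rewrite Cmod_Cexp, <- (exp_ln R HR); now apply exp_increasing. }
assert (Step : forall k w, Re w <= ln rho + INR k * (r / 4) -> Re w + r < ln R ->
  g w = RtoC 0).
{ induction k as [|k IH]; intros w Hw1 Hw2.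
  - apply Hz; replace (c + Cexp w - c)%C with (Cexp w) by ring.
    rewrite Cmod_Cexp, <- (exp_ln rho Hrho); apply exp_le_compat.
    simpl in Hw1; lra.
  - apply (vanish_step g w r Hr).
    + intros eps He; destruct (Happ eps He) as [G HG].
      exists (fun v => G (c + Cexp v)%C); intros v Hv.
      assert (Rv : Re v < ln R).
      { assert (A := re_le_Cmod (v - w)%C); apply Rabs_le_between in A.
        replace (Re (v - w)%C) with (Re v - Re w) in A by reflexivity; lra. }
      destruct (HG _ (Inside v Rv)) as [D E]; split; [|exact E].
      apply (cdiff_comp G (fun v => c + Cexp v)%C); [|exact D].
      apply cdiff_plus; [apply cdiff_const|apply cdiff_Cexp].
    + intros v _ Hv; apply IH; [rewrite S_INR in Hw1; lra|lra]. }
destruct (INR_unbounded ((ln m - ln rho) / (r / 4))) as [k Hk].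
replace z with (c + Cexp (ln m, t))%C by (rewrite Ht; ring).
apply (Step k).
- apply Rlt_div_l in Hk; [simpl|]; lra.
- simpl; unfold r; lra.
Qed.

(** A non-real point is reached from [1 < Re z] along its horizontal line, by discs too small to
    meet the real axis. A real point other than 1 lies in a small disc centred above it, near whose
    centre all points are non-real. No disc contains the pole. *)
Lemma vanish_continuation (F : C -> C) (s0 : R) :
  (forall c R, 0 < R ->
     (forall z, Cmod (z - c) <= R -> s0 < Re z /\ z <> RtoC 1) ->
     approx F (fun z => Cmod (z - c) < R)) ->
  (forall z, 1 < Re z -> F z = RtoC 0) ->
  forall z, s0 < Re z -> z <> RtoC 1 -> F z = RtoC 0.
Proof.
intros Happ Hz.
assert (Off : forall z, s0 < Re z -> Im z <> 0 -> F z = RtoC 0).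
{ intros [x y] Hx Hy; simpl in Hx, Hy.
  assert (Py := Rabs_pos_lt _ Hy).
  set (r := Rmin (Rabs y) (x - s0) / 2).
  assert (Hr : 0 < r).
  { assert (0 < Rmin (Rabs y) (x - s0)) by (apply Rmin_pos; lra); unfold r; lra. }
  assert (R1 : r < Rabs y).
  { assert (A := Rmin_l (Rabs y) (x - s0)); unfold r in *; lra. }
  assert (R2 : r < x - s0).
  { assert (A := Rmin_r (Rabs y) (x - s0)); unfold r in *; lra. }
  destruct (INR_unbounded ((1 + r - x) / (r / 2))) as [N HN].
  apply Rlt_div_l in HN; [|lra].
  (* The chain runs from right to left. Its centres are [r / 2] apart, so the disc of radius [r / 4]
     about the next centre lies inside the disc of radius [r] about the present one. *)
  assert (Chain : forall k, (k <= N)%nat -> forall z,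
    Cmod (z - ((x + INR (N - k) * (r / 2))%R, y)) <= r / 4 -> F z = RtoC 0).
  { induction k as [|k IH]; intros Hk z Hzc.
    - apply Hz; rewrite Nat.sub_0_r in Hzc.
      assert (A := re_le_Cmod (z - ((x + INR N * (r / 2))%R, y))%C).
      apply Rabs_le_between in A; simpl in A; unfold Re in *; lra.
    - apply (vanish_disc F ((x + INR (N - k) * (r / 2))%R, y) r (r / 4)); [lra|lra| | |].
      + apply Happ; [exact Hr|]; intros w Hw.
        assert (A := re_le_Cmod (w - ((x + INR (N - k) * (r / 2))%R, y))%C).
        assert (B := im_le_Cmod (w - ((x + INR (N - k) * (r / 2))%R, y))%C).
        assert (PN := pos_INR (N - k)).
        split.
        * apply Rabs_le_between in A; simpl in A; unfold Re in *; nra.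
        * intros ->; simpl in B; rewrite Rplus_0_l, Rabs_Ropp in B; lra.
      + apply IH; lia.
      + replace (z - ((x + INR (N - k) * (r / 2))%R, y))%C
          with ((z - ((x + INR (N - S k) * (r / 2))%R, y)) + RtoC (- (r / 2)))%C.
        * eapply Rle_lt_trans; [apply Cmod_triangle|].
          rewrite Cmod_R, Rabs_Ropp, Rabs_pos_eq by lra; lra.
        * replace (N - k)%nat with (S (N - S k)) by lia; rewrite S_INR.
          apply injective_projections; simpl; ring. }
  apply (Chain N (le_n N)).
  rewrite Nat.sub_diag; simpl; rewrite Rmult_0_l, Rplus_0_r.
  replace ((x, y) - (x, y))%C with (RtoC 0) by ring; rewrite Cmod_0; lra. }
intros z Hx Hz1.
destruct (Req_dec (Im z) 0) as [Hy|Hy]; [|now apply Off].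
destruct z as [x y]; simpl in Hx, Hy; subst y.
assert (Hx1 : x <> 1) by (intros ->; now apply Hz1).
assert (Px : 0 < Rabs (x - 1)) by (apply Rabs_pos_lt; lra).
set (e := Rmin (Rabs (x - 1)) (x - s0) / 4).
assert (He : 0 < e).
{ assert (0 < Rmin (Rabs (x - 1)) (x - s0)) by (apply Rmin_pos; lra); unfold e; lra. }
assert (E1 : 3 * e < Rabs (x - 1)).
{ assert (A := Rmin_l (Rabs (x - 1)) (x - s0)); unfold e in *; lra. }
assert (E2 : 3 * e < x - s0).
{ assert (A := Rmin_r (Rabs (x - 1)) (x - s0)); unfold e in *; lra. }
apply (vanish_disc F (x, e) (2 * e) (e / 2)); [lra|lra| | |].
- apply Happ; [lra|]; intros w Hw.
  assert (A := re_le_Cmod (w - (x, e))%C); simpl in A; unfold Re in *.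
  split.
  + apply Rabs_le_between in A; lra.
  + intros ->; simpl in A; rewrite <- Rabs_Ropp in A.
    replace (- (1 + - x)) with (x - 1) in A by ring; lra.
- intros w Hw.
  assert (A := re_le_Cmod (w - (x, e))%C); simpl in A.
  assert (B := im_le_Cmod (w - (x, e))%C); simpl in B.
  apply Rabs_le_between in A; apply Rabs_le_between in B.
  apply Off; unfold Re, Im in *; lra.
- replace ((x, 0) - (x, e))%C with (Ci * RtoC (- e))%C
    by (apply injective_projections; simpl; ring).
  rewrite Cmod_mult, Cmod_Ci, Cmod_R, Rabs_Ropp, Rabs_pos_eq by lra; lra.
Qed.

(** * Bernoulli sums *)

(** Summation over [k < n], since the empty sum is needed for [D = 0]. *)
Fixpoint rsum (f : nat -> R) (n : nat) : R :=
  match n with O => 0 | S n => rsum f n + f n end.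

Lemma rsum_ext (f g : nat -> R) (n : nat) :
  (forall k, (k < n)%nat -> f k = g k) -> rsum f n = rsum g n.
Proof. induction n as [|n IH]; intros H; simpl; [|rewrite IH, H]; auto. Qed.

Lemma rsum_le (f g : nat -> R) (n : nat) :
  (forall k, (k < n)%nat -> f k <= g k) -> rsum f n <= rsum g n.
Proof. induction n as [|n IH]; intros H; simpl; [lra|apply Rplus_le_compat; auto]. Qed.

Lemma rsum_plus (f g : nat -> R) (n : nat) :
  rsum (fun k => f k + g k) n = rsum f n + rsum g n.
Proof. induction n as [|n IH]; simpl; [|rewrite IH]; ring. Qed.

Lemma rsum_scal (c : R) (f : nat -> R) (n : nat) :
  rsum (fun k => c * f k) n = c * rsum f n.
Proof. induction n as [|n IH]; simpl; [|rewrite IH]; ring. Qed.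

Lemma rsum_minus (f g : nat -> R) (n : nat) :
  rsum (fun k => f k - g k) n = rsum f n - rsum g n.
Proof. induction n as [|n IH]; simpl; [|rewrite IH]; ring. Qed.

Lemma rsum_const (c : R) (n : nat) : rsum (fun _ => c) n = INR n * c.
Proof. induction n as [|n IH]; [simpl; ring|cbn [rsum]; rewrite IH, S_INR; ring]. Qed.

Lemma rsum_zero (f : nat -> R) (n : nat) :
  (forall k, (k < n)%nat -> f k = 0) -> rsum f n = 0.
Proof. intros H; rewrite (rsum_ext f (fun _ => 0)), rsum_const by exact H; ring. Qed.

Lemma rsum_swap (f : nat -> nat -> R) (n m : nat) :
  rsum (fun i => rsum (f i) m) n = rsum (fun j => rsum (fun i => f i j) n) m.
Proof.
induction n as [|n IH]; simpl.
- symmetry; apply rsum_zero; reflexivity.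
- now rewrite IH, rsum_plus.
Qed.

Lemma rsum_abs (f : nat -> R) (n : nat) : Rabs (rsum f n) <= rsum (fun k => Rabs (f k)) n.
Proof.
induction n as [|n IH]; simpl; [rewrite Rabs_R0; lra|].
eapply Rle_trans; [apply Rabs_triang|lra].
Qed.

Lemma rsum_split (f : nat -> R) (n m : nat) :
  rsum f (n + m) = rsum f n + rsum (fun k => f (n + k)%nat) m.
Proof.
induction m as [|m IH]; [rewrite Nat.add_0_r; simpl; ring|].
rewrite Nat.add_succ_r; simpl; rewrite IH; ring.
Qed.

Lemma rsum_single (f : nat -> R) (n j : nat) : (j < n)%nat ->
  (forall k, (k < n)%nat -> k <> j -> f k = 0) -> rsum f n = f j.
Proof.
intros Hj H; induction n as [|n IH]; [lia|]; simpl.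
destruct (Nat.eq_dec n j) as [->|Hne].
- rewrite rsum_zero; [ring|]; intros k Hk; apply H; lia.
- rewrite IH, (H n) by (intros; try apply H; lia); ring.
Qed.

Lemma sum_f_R0_rsum (f : nat -> R) (n : nat) : sum_f_R0 f n = rsum f (S n).
Proof. induction n as [|n IH]; [simpl; ring|]; rewrite tech5, IH; reflexivity. Qed.

(* Unlike [Binomial.C], which is [n! / k!] for [k > n], [bin n k] vanishes there. *)
Fixpoint bin (n k : nat) : R :=
  match n, k with
  | _, O => 1
  | O, S _ => 0
  | S n, S k => bin n k + bin n (S k)
  end.

Lemma bin_0_r (n : nat) : bin n 0 = 1.
Proof. now destruct n. Qed.

Lemma bin_gt (n k : nat) : (n < k)%nat -> bin n k = 0.
Proof.
revert k; induction n as [|n IH]; intros [|k] Hk; try lia; [reflexivity|]; simpl.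
rewrite !IH by lia; ring.
Qed.

Lemma bin_diag (n : nat) : bin n n = 1.
Proof. induction n as [|n IH]; [reflexivity|]; simpl; rewrite IH, bin_gt by lia; ring. Qed.

Lemma bin_C (n k : nat) : (k <= n)%nat -> bin n k = Binomial.C n k.
Proof.
revert k; induction n as [|n IH]; intros k Hk.
- replace k with 0%nat by lia; unfold Binomial.C; simpl; field.
- destruct k as [|k].
  + rewrite bin_0_r; unfold Binomial.C; rewrite Nat.sub_0_r.
    change (INR (fact 0)) with 1; field; apply INR_fact_neq_0.
  + destruct (Nat.eq_dec k n) as [->|Hne].
    * rewrite bin_diag; unfold Binomial.C; rewrite Nat.sub_diag; change (INR (fact 0)) with 1.
      field; apply INR_fact_neq_0.
    * simpl bin; rewrite !IH, pascal by lia; reflexivity.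
Qed.

Lemma bin_fact (n k : nat) : (k <= n)%nat ->
  bin n k * (INR (fact k) * INR (fact (n - k))) = INR (fact n).
Proof.
intros H; rewrite bin_C by exact H; unfold Binomial.C; field.
split; apply INR_fact_neq_0.
Qed.

Lemma bin_nonneg (n k : nat) : 0 <= bin n k.
Proof.
revert k; induction n as [|n IH]; intros [|k]; simpl; try lra.
apply Rplus_le_le_0_compat; apply IH.
Qed.

Lemma bin_ge_1 (n k : nat) : (k <= n)%nat -> 1 <= bin n k.
Proof.
revert k; induction n as [|n IH]; intros [|k] Hk; simpl; try lia; try lra.
assert (A := IH k ltac:(lia)); assert (B := bin_nonneg n (S k)); lra.
Qed.

Lemma bin_trinomial (n t j : nat) : (j <= t <= n)%nat ->
  bin n t * bin t j = bin n j * bin (n - j) (t - j).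
Proof.
intros H.
assert (A1 := bin_fact n t ltac:(lia)); assert (A2 := bin_fact t j ltac:(lia)).
assert (A3 := bin_fact n j ltac:(lia)); assert (A4 := bin_fact (n - j) (t - j) ltac:(lia)).
replace (n - j - (t - j))%nat with (n - t)%nat in A4 by lia.
assert (P1 := INR_fact_lt_0 j); assert (P2 := INR_fact_lt_0 (t - j)).
assert (P3 := INR_fact_lt_0 (n - t)).
set (fj := INR (fact j)) in *; set (fu := INR (fact (t - j))) in *; set (fv := INR (fact (n - t))) in *.
apply Rmult_eq_reg_r with (fj * (fu * fv)).
2:{ apply Rgt_not_eq; repeat apply Rmult_lt_0_compat; assumption. }
replace (bin n t * bin t j * (fj * (fu * fv))) with (bin n t * (bin t j * (fj * fu) * fv)) by ring.
rewrite A2, A1, <- A3, <- A4; ring.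
Qed.

Lemma binomial_theorem (M : R) (n : nat) :
  (M + 1) ^ n = rsum (fun r => bin n r * M ^ (n - r)) (S n).
Proof.
rewrite Rplus_comm, binomial, sum_f_R0_rsum; apply rsum_ext; intros k Hk.
rewrite bin_C by lia; rewrite pow1; ring.
Qed.

(** Trinomial revision followed by the binomial theorem. The factor [bin n t * M ^ (n - t)] does not
    involve [j], so Bernoulli sums over [j] can be collected order by order in [t]. *)
Lemma binomial_theorem_shifted (M : R) (n j : nat) : (j <= n)%nat ->
  rsum (fun t => bin n t * bin t j * M ^ (n - t)) (S n) = bin n j * (M + 1) ^ (n - j).
Proof.
intros Hj; replace (S n) with (j + S (n - j))%nat by lia.
rewrite rsum_split, rsum_zero, Rplus_0_l.
2:{ intros k Hk; rewrite (bin_gt k j) by exact Hk; ring. }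
rewrite binomial_theorem, <- rsum_scal; apply rsum_ext; intros k Hk.
rewrite bin_trinomial by lia.
replace (j + k - j)%nat with k by lia; replace (n - (j + k))%nat with (n - j - k)%nat by lia.
ring.
Qed.

Lemma bernoulli_sum (t : nat) :
  rsum (fun j => bin t j * bernoulli j) t = if Nat.eq_dec t 1 then 1 else 0.
Proof.
destruct t as [|[|t]]; destruct Nat.eq_dec as [E|E]; try lia.
- reflexivity.
- simpl; rewrite bernoulli_0; ring.
- assert (B := bernoulli_rec (S t) ltac:(lia)).
  rewrite sum_f_R0_rsum in B; replace (S t + 1)%nat with (S (S t)) in B by lia.
  rewrite <- B; apply rsum_ext; intros k Hk; rewrite bin_C by lia; reflexivity.
Qed.

(* With [n = i + 1], [bsum n d x] collects the terms [j < d] of the Bernoulli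
   sum for the exponent [i]. *)
Definition bsum (n d : nat) (x : R) : R :=
  rsum (fun j => bin n j * bernoulli j * x ^ (n - j)) d.

(** The coefficient of order [t] in the difference of [bsum n d]. For [t <= d] the Bernoulli
    recursion reduces it to 1 at [t = 1] and 0 elsewhere. *)
Definition bcoef (d t : nat) : R :=
  rsum (fun j => bin t j * bernoulli j) d - (if lt_dec t d then bernoulli t else 0).

Lemma bsum_diff (n d : nat) (x : R) : (d <= n)%nat ->
  bsum n d (x + 1) - bsum n d x = rsum (fun t => bin n t * x ^ (n - t) * bcoef d t) (S n).
Proof.
intros Hd.
assert (E1 : bsum n d (x + 1) =
  rsum (fun t => bin n t * x ^ (n - t) * rsum (fun j => bin t j * bernoulli j) d) (S n)).
{ unfold bsum.
  rewrite (rsum_ext _ (fun j => rsum (fun t => bin n t * x ^ (n - t) * (bin t j * bernoulli j)) (S n))).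
  - rewrite rsum_swap; apply rsum_ext; intros t Ht; now rewrite rsum_scal.
  - intros j Hj.
    replace (bin n j * bernoulli j * (x + 1) ^ (n - j))
      with (bernoulli j * (bin n j * (x + 1) ^ (n - j))) by ring.
    rewrite <- binomial_theorem_shifted, <- rsum_scal by lia.
    apply rsum_ext; intros t Ht; ring. }
assert (E2 : bsum n d x =
  rsum (fun t => bin n t * x ^ (n - t) * (if lt_dec t d then bernoulli t else 0)) (S n)).
{ replace (S n) with (d + (S n - d))%nat by lia.
  rewrite rsum_split, (rsum_zero (fun k => bin n (d + k) * _ * _)), Rplus_0_r.
  - apply rsum_ext; intros t Ht; destruct lt_dec as [L|L]; [ring|lia].
  - intros k Hk; destruct lt_dec as [L|L]; [lia|ring]. }
rewrite E1, E2, <- rsum_minus; apply rsum_ext; intros t Ht; unfold bcoef; ring.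
Qed.

Lemma bcoef_le (d t : nat) : (t <= d)%nat -> bcoef d t = if Nat.eq_dec t 1 then 1 else 0.
Proof.
intros H; rewrite <- bernoulli_sum; unfold bcoef.
destruct (Nat.eq_dec t d) as [->|Hne].
- destruct lt_dec as [L|L]; [lia|ring].
- destruct lt_dec as [L|L]; [|lia].
  replace d with (S t + (d - S t))%nat by lia.
  rewrite rsum_split, (rsum_zero (fun k => bin t (S t + k) * _)).
  + simpl rsum; rewrite bin_diag; ring.
  + intros k Hk; rewrite bin_gt by lia; ring.
Qed.

Lemma bsum_0 (n d : nat) : (d <= n)%nat -> bsum n d 0 = 0.
Proof.
intros H; apply rsum_zero; intros k Hk; rewrite pow_i by lia; ring.
Qed.

(** With [d = n = i + 1] every order [t] falls under [bcoef_le], and the one surviving term,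
    [t = 1], makes the difference equal to [(i + 1) * x^i]. *)
Lemma faulhaber (i M : nat) :
  bsum (S i) (S i) (INR M) = INR (S i) * rsum (fun m => INR m ^ i) M.
Proof.
induction M as [|M IH]; [simpl (INR 0); rewrite bsum_0 by lia; simpl; ring|].
assert (D := bsum_diff (S i) (S i) (INR M) (le_n _)).
rewrite S_INR; cbn [rsum]; rewrite Rmult_plus_distr_l, <- IH.
apply Rplus_eq_reg_l with (- bsum (S i) (S i) (INR M)).
rewrite (Rplus_comm _ (bsum _ _ (INR M + 1))); unfold Rminus in D; rewrite D.
rewrite (rsum_single _ _ 1%nat); [|lia|].
2:{ intros k Hk Hk1; rewrite bcoef_le by lia; destruct Nat.eq_dec; [lia|ring]. }
rewrite bcoef_le by lia; destruct Nat.eq_dec as [_|n]; [|lia].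
replace (bin (S i) 1) with (INR (S i)).
{ simpl (S i - 1)%nat; rewrite Nat.sub_0_r; ring. }
clear; induction i as [|i IH]; [simpl; ring|].
rewrite S_INR, IH; change (bin (S (S i)) 1) with (bin (S i) 0 + bin (S i) 1).
rewrite bin_0_r; ring.
Qed.

(** Both coefficients times their two factorials equal [t!]. This crude comparison replaces all
    [bin t j] with [j < D] by one coefficient. *)
Lemma bin_le_shift (t j k : nat) : (j <= k <= t)%nat ->
  bin t j <= INR (fact k) * bin t k.
Proof.
intros H.
assert (A1 := bin_fact t j ltac:(lia)); assert (A2 := bin_fact t k ltac:(lia)).
assert (P1 : 1 <= INR (fact j)) by (apply (le_INR 1), lt_O_fact).
assert (P2 : INR (fact (t - k)) <= INR (fact (t - j))) by (apply le_INR, fact_le; lia).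
assert (P3 : 1 <= INR (fact (t - k))) by (apply (le_INR 1), lt_O_fact).
assert (B := bin_nonneg t j).
apply Rmult_le_reg_r with (INR (fact (t - k))); [lra|].
rewrite (Rmult_comm (INR (fact k))), Rmult_assoc, A2, <- A1.
apply Rmult_le_compat_l; [exact B|]; nra.
Qed.

(** The 1 bounds [bcoef n t] for the full sum; the factorial is the one of [bin_le_shift]. *)
Definition bern_const (D : nat) : R :=
  1 + INR (fact (S D)) * rsum (fun j => Rabs (bernoulli j)) D.

Lemma bern_const_pos (D : nat) : 0 < bern_const D.
Proof.
unfold bern_const.
assert (A : 0 <= rsum (fun j => Rabs (bernoulli j)) D).
{ rewrite <- (Rmult_0_r (INR D)), <- rsum_const; apply rsum_le; intros; apply Rabs_pos. }
assert (B := pos_INR (fact (S D))); nra.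
Qed.

(** For [t <= D] the two coefficients coincide by [bcoef_le], which permits a bound by
    [bin t (S D)], zero at these orders. This cancellation is the source of the gain [M^(-D)] in
    [btail_bound]. *)
Lemma bcoef_diff_bound (D n t : nat) : (D <= n)%nat -> (t <= n)%nat ->
  Rabs (bcoef n t - bcoef D t) <= bern_const D * bin t (S D).
Proof.
intros HD Ht; rewrite (bcoef_le n t Ht).
assert (PB := bin_nonneg t (S D)); assert (PK := bern_const_pos D).
destruct (le_lt_dec t D) as [L|L].
- rewrite bcoef_le, Rminus_diag, Rabs_R0 by exact L; nra.
- unfold bcoef; destruct (lt_dec t D) as [?|_]; [lia|]; rewrite Rminus_0_r.
  assert (B1 : Rabs (rsum (fun j => bin t j * bernoulli j) D)
    <= INR (fact (S D)) * bin t (S D) * rsum (fun j => Rabs (bernoulli j)) D).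
  { eapply Rle_trans; [apply rsum_abs|]; rewrite <- rsum_scal; apply rsum_le; intros j Hj.
    rewrite Rabs_mult, (Rabs_pos_eq (bin t j)) by apply bin_nonneg.
    apply Rmult_le_compat_r; [apply Rabs_pos|]; apply bin_le_shift; lia. }
  assert (B2 := bin_ge_1 t (S D) L).
  assert (B3 : Rabs (if Nat.eq_dec t 1 then 1 else 0) <= 1).
  { destruct Nat.eq_dec; [rewrite Rabs_R1|rewrite Rabs_R0]; lra. }
  unfold Rminus; eapply Rle_trans; [apply Rabs_triang|]; rewrite Rabs_Ropp.
  unfold bern_const; lra.
Qed.

Definition btail (D i : nat) (x : R) : R := bsum (S i) (S i) x - bsum (S i) D x.

(** The difference in [M] contains only orders [t > D], hence is at most a multiple of
    [(m + 1)^(i - D)]; summing [M] such differences, starting from the value 0 at 0, yields one more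
    power of [M]. *)
Lemma btail_bound (D i M : nat) : (D <= i)%nat ->
  Rabs (btail D i (INR M)) <= bern_const D * bin (S i) (S D) * INR M ^ (S i - D).
Proof.
intros HD.
set (K := bern_const D * bin (S i) (S D)).
assert (HK : 0 <= K) by (apply Rmult_le_pos; [left; apply bern_const_pos|apply bin_nonneg]).
assert (Step : forall m, Rabs (btail D i (INR (S m)) - btail D i (INR m)) <= K * INR (S m) ^ (i - D)).
{ intros m; rewrite S_INR; unfold btail.
  replace (bsum (S i) (S i) (INR m + 1) - bsum (S i) D (INR m + 1)
    - (bsum (S i) (S i) (INR m) - bsum (S i) D (INR m)))
    with ((bsum (S i) (S i) (INR m + 1) - bsum (S i) (S i) (INR m))
      - (bsum (S i) D (INR m + 1) - bsum (S i) D (INR m))) by ring.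
  rewrite !bsum_diff, <- rsum_minus by lia.
  eapply Rle_trans; [apply rsum_abs|].
  replace (K * (INR m + 1) ^ (i - D))
    with (bern_const D * (bin (S i) (S D) * (INR m + 1) ^ (S i - S D)))
    by (unfold K; simpl; ring).
  (* Expands [(m + 1)^(i - D)] into the same orders [t] as the left side, with [j = S D]. *)
  rewrite <- binomial_theorem_shifted, <- rsum_scal by lia.
  apply rsum_le; intros t Ht.
  assert (P1 := bin_nonneg (S i) t).
  assert (P2 := pow_le _ (S i - t) (pos_INR m)).
  rewrite <- Rmult_minus_distr_l, Rabs_mult, Rabs_pos_eq by (now apply Rmult_le_pos).
  replace (bern_const D * (bin (S i) t * bin t (S D) * INR m ^ (S i - t)))
    with (bin (S i) t * INR m ^ (S i - t) * (bern_const D * bin t (S D))) by ring.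
  apply Rmult_le_compat_l; [now apply Rmult_le_pos|].
  apply bcoef_diff_bound; lia. }
assert (Sum : Rabs (btail D i (INR M)) <= rsum (fun m => K * INR (S m) ^ (i - D)) M).
{ clear - Step HD; induction M as [|M IH].
  - unfold btail; simpl (INR 0); rewrite !bsum_0, Rminus_diag, Rabs_R0 by lia; simpl; lra.
  - cbn [rsum].
    replace (btail D i (INR (S M)))
      with (btail D i (INR M) + (btail D i (INR (S M)) - btail D i (INR M))) by ring.
    eapply Rle_trans; [apply Rabs_triang|]; apply Rplus_le_compat; auto. }
eapply Rle_trans; [exact Sum|].
eapply Rle_trans.
{ apply rsum_le with (g := fun _ => K * INR M ^ (i - D)); intros m Hm.
  apply Rmult_le_compat_l; [exact HK|].
  apply pow_incr; split; [apply pos_INR|apply le_INR; lia]. }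
rewrite rsum_const; replace (S i - D)%nat with (S (i - D)) by lia; simpl; lra.
Qed.

Lemma btail_succ (D i : nat) (x : R) :
  btail D i x = bin (S i) D * bernoulli D * x ^ (S i - D) + btail (S D) i x.
Proof. unfold btail, bsum; simpl; ring. Qed.

Lemma btail_diag (i : nat) (x : R) : btail (S i) i x = 0.
Proof. unfold btail; ring. Qed.

(** * The binomial series *)

(* [rho s i] is the rising factorial [s (s + 1) ... (s + i - 1)] over [i!]. *)
Fixpoint rho (s : C) (i : nat) : C :=
  match i with
  | O => RtoC 1
  | S i => (rho s i * (s + RtoC (INR i)) / RtoC (INR (S i)))%C
  end.

Lemma RtoC_neq_0 (x : R) : x <> 0 -> RtoC x <> RtoC 0.
Proof. intros H E; apply H, RtoC_inj, E. Qed.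

Lemma INR_S_neq_0 (n : nat) : INR (S n) <> 0.
Proof. apply not_0_INR; lia. Qed.

Lemma Cmod_rho_S (s : C) (i : nat) :
  Cmod (rho s (S i)) = Cmod (rho s i) * (Cmod (s + RtoC (INR i)) / INR (S i)).
Proof.
cbn [rho]; rewrite Cmod_div by apply RtoC_neq_0, INR_S_neq_0.
rewrite Cmod_mult, Cmod_R, (Rabs_pos_eq (INR (S i))) by apply pos_INR.
unfold Rdiv; ring.
Qed.

Lemma Cmod_rho_real (A : R) (i : nat) : 0 < A ->
  Cmod (RtoC A + RtoC (INR i)) = A + INR i.
Proof.
intros HA; assert (P := pos_INR i).
rewrite <- RtoC_plus, Cmod_R, Rabs_pos_eq; lra.
Qed.

(** One positive parameter [A] serves a whole disc of [s], as the uniform estimates require. *)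
Lemma Cmod_rho_le (s : C) (A : R) (i : nat) : 0 < A -> Cmod s <= A ->
  Cmod (rho s i) <= Cmod (rho (RtoC A) i).
Proof.
intros HA Hs; induction i as [|i IH]; [simpl; lra|].
rewrite !Cmod_rho_S, Cmod_rho_real by exact HA.
assert (P := pos_INR i); assert (Q : 0 < INR (S i)) by (apply lt_0_INR; lia).
apply Rmult_le_compat; [apply Cmod_ge_0| |exact IH|].
- apply Rdiv_le_0_compat; [apply Cmod_ge_0|exact Q].
- apply Rmult_le_compat_r; [left; now apply Rinv_0_lt_compat|].
  eapply Rle_trans; [apply Cmod_triangle|].
  rewrite Cmod_R, Rabs_pos_eq by exact P; lra.
Qed.

Lemma Cmod_rho_pos (A : R) (i : nat) : 0 < A -> 0 < Cmod (rho (RtoC A) i).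
Proof.
intros HA; induction i as [|i IH]; [simpl; rewrite Cmod_1; lra|].
rewrite Cmod_rho_S, Cmod_rho_real by exact HA.
assert (P := pos_INR i); assert (Q : 0 < INR (S i)) by (apply lt_0_INR; lia).
apply Rmult_lt_0_compat; [exact IH|]; apply Rdiv_lt_0_compat; lra.
Qed.

Lemma ex_series_rho (A x : R) : 0 < A -> 0 < x < 1 ->
  ex_series (fun i => Cmod (rho (RtoC A) i) * x ^ i).
Proof.
intros HA Hx.
assert (Pos : forall i, 0 < Cmod (rho (RtoC A) i) * x ^ i).
{ intros i; apply Rmult_lt_0_compat; [now apply Cmod_rho_pos|apply pow_lt; lra]. }
apply ex_series_ext with (fun i => Rabs (Cmod (rho (RtoC A) i) * x ^ i)).
{ intros i; apply Rabs_pos_eq; left; apply Pos. }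
apply ex_series_DAlembert with x; [lra|intros i; apply Rgt_not_eq, Pos|].
apply is_lim_seq_ext with (fun i => (1 + (A - 1) * / INR (S i)) * x).
- intros i; rewrite Cmod_rho_S, Cmod_rho_real by exact HA.
  assert (P := pos_INR i); assert (Q := Cmod_rho_pos A i HA); assert (X := pow_lt x i (proj1 Hx)).
  rewrite S_INR; symmetry.
  replace (Cmod (rho A i) * ((A + INR i) / (INR i + 1)) * x ^ S i / (Cmod (rho A i) * x ^ i))
    with ((1 + (A - 1) * / (INR i + 1)) * x) by (simpl; field; lra).
  apply Rabs_pos_eq.
  replace (1 + (A - 1) * / (INR i + 1)) with ((A + INR i) / (INR i + 1)) by (field; lra).
  apply Rmult_le_pos; [apply Rdiv_le_0_compat|]; lra.
- replace (Finite x) with (Finite ((1 + (A - 1) * 0) * x)) by (f_equal; ring).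
  apply is_lim_seq_mult'; [|apply is_lim_seq_const].
  apply is_lim_seq_plus'; [apply is_lim_seq_const|].
  apply is_lim_seq_mult'; [apply is_lim_seq_const|].
  apply (is_lim_seq_incr_1 (fun i => / INR i)).
  apply (is_lim_seq_inv INR p_infty); [apply is_lim_seq_INR|discriminate].
Qed.

(** The domination hypothesis covers the real and the imaginary parts of [rho s] alike. *)
Lemma CV_radius_rho (s : C) (a : nat -> R) (x : R) : Rabs x < 1 ->
  (forall i, Rabs (a i) <= Cmod (rho s i)) -> Rbar_lt (Rabs x) (CV_radius a).
Proof.
intros Hx Ha.
set (r := (Rabs x + 1) / 2).
assert (Px := Rabs_pos x).
assert (Hr : 0 < r < 1) by (unfold r; lra).
apply Rbar_lt_le_trans with r; [simpl; unfold r; lra|].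
apply (proj1 (Lub_Rbar_correct (CV_disk a))).
assert (Ps := Cmod_ge_0 s).
apply (ex_series_le (V := R_CompleteNormedModule)
  (fun n => Rabs (a n * r ^ n)) (fun i => Cmod (rho (RtoC (Cmod s + 1)) i) * r ^ i)).
- intros i; change (Rabs (Rabs (a i * r ^ i)) <= Cmod (rho (RtoC (Cmod s + 1)) i) * r ^ i).
  rewrite Rabs_Rabsolu, Rabs_mult, (Rabs_pos_eq (r ^ i)) by (apply pow_le; lra).
  apply Rmult_le_compat_r; [apply pow_le; lra|].
  eapply Rle_trans; [apply Ha|]; apply Cmod_rho_le; lra.
- apply ex_series_rho; lra.
Qed.

Lemma is_series_C (a : nat -> C) (lr li : R) :
  is_series (fun i => Re (a i)) lr -> is_series (fun i => Im (a i)) li ->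
  is_series a (lr, li).
Proof.
intros Hr Hi.
assert (E : forall n, sum_n a n = (sum_n (fun i => Re (a i)) n, sum_n (fun i => Im (a i)) n)).
{ induction n as [|n IH]; [rewrite !sum_O; apply surjective_pairing|].
  rewrite !sum_Sn, IH; reflexivity. }
intros P [eps HP].
specialize (Hr (ball lr eps) (locally_ball lr eps)).
specialize (Hi (ball li eps) (locally_ball li eps)).
destruct Hr as [N1 H1]; destruct Hi as [N2 H2].
exists (max N1 N2); intros n Hn; apply HP; rewrite E.
split; [apply H1|apply H2]; lia.
Qed.

Lemma re_Cmult (x y : C) : Re (x * y) = Re x * Re y - Im x * Im y.
Proof. reflexivity. Qed.

Lemma im_Cmult (x y : C) : Im (x * y) = Re x * Im y + Im x * Re y.
Proof. reflexivity. Qed.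

Lemma rho_recurrence (s : C) (i : nat) :
  (RtoC (INR (S i)) * rho s (S i) = (s + RtoC (INR i)) * rho s i)%C.
Proof. cbn [rho]; field; apply RtoC_neq_0, INR_S_neq_0. Qed.

(** The equation [(1 - x) f' = s f] for [f = f1 + i f2], split into real power series; comparing
    coefficients gives [rho_recurrence]. *)
Lemma rho_ode (s : C) (x : R) : Rabs x < 1 ->
  let f1 := PSeries (fun i => Re (rho s i)) in
  let f2 := PSeries (fun i => Im (rho s i)) in
  is_derive f1 x ((Re s * f1 x - Im s * f2 x) / (1 - x)) /\
  is_derive f2 x ((Re s * f2 x + Im s * f1 x) / (1 - x)).
Proof.
intros Hx f1 f2.
set (a := fun i => Re (rho s i)) in *; set (b := fun i => Im (rho s i)) in *.
assert (Ra : Rbar_lt (Rabs x) (CV_radius a))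
  by (apply (CV_radius_rho s); [exact Hx|intros; apply re_le_Cmod]).
assert (Rb : Rbar_lt (Rabs x) (CV_radius b))
  by (apply (CV_radius_rho s); [exact Hx|intros; apply im_le_Cmod]).
assert (Ea : ex_pseries a x) by now apply CV_radius_inside.
assert (Eb : ex_pseries b x) by now apply CV_radius_inside.
assert (Eda : ex_pseries (PS_derive a) x) by (apply CV_radius_inside; now rewrite CV_radius_derive).
assert (Edb : ex_pseries (PS_derive b) x) by (apply CV_radius_inside; now rewrite CV_radius_derive).
assert (Hx1 : 1 - x <> 0) by (apply Rabs_def2 in Hx; lra).
assert (Rec : forall i, INR (S i) * a (S i) = (Re s + INR i) * a i - Im s * b i /\
   INR (S i) * b (S i) = (Re s + INR i) * b i + Im s * a i).
{ intros i; assert (E := rho_recurrence s i).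
  assert (E1 := f_equal Re E); assert (E2 := f_equal Im E).
  rewrite re_scal_l, re_Cmult in E1; rewrite im_scal_l, im_Cmult in E2.
  unfold a, b; rewrite E1, E2; simpl; unfold Re, Im; split; ring. }
assert (Shift : forall d, ex_pseries d x ->
  PSeries (PS_minus d (PS_incr_1 d)) x = (1 - x) * PSeries d x).
{ intros d Hd; rewrite PSeries_minus, PSeries_incr_1; [ring|exact Hd|].
  apply ex_pseries_incr_1, Hd. }
assert (D1 : (1 - x) * PSeries (PS_derive a) x = Re s * f1 x - Im s * f2 x).
{ rewrite <- Shift by exact Eda; unfold f1, f2.
  rewrite <- !PSeries_scal, <- PSeries_minus;
    try (apply ex_pseries_scal; [apply Rmult_comm|assumption]).
  apply PSeries_ext; intros [|i].
  - change (INR 1 * a 1%nat - 0 = Re s * a 0%nat - Im s * b 0%nat).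
    destruct (Rec 0%nat) as [R1 _]; rewrite R1; simpl; ring.
  - change (INR (S (S i)) * a (S (S i)) - INR (S i) * a (S i) = Re s * a (S i) - Im s * b (S i)).
    destruct (Rec (S i)) as [R1 _]; rewrite R1; ring. }
assert (D2 : (1 - x) * PSeries (PS_derive b) x = Re s * f2 x + Im s * f1 x).
{ rewrite <- Shift by exact Edb; unfold f1, f2.
  rewrite <- !PSeries_scal, <- PSeries_plus;
    try (apply ex_pseries_scal; [apply Rmult_comm|assumption]).
  apply PSeries_ext; intros [|i].
  - change (INR 1 * b 1%nat - 0 = Re s * b 0%nat + Im s * a 0%nat).
    destruct (Rec 0%nat) as [_ R1]; rewrite R1; simpl; ring.
  - change (INR (S (S i)) * b (S (S i)) - INR (S i) * b (S i) = Re s * b (S i) + Im s * a (S i)).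
    destruct (Rec (S i)) as [_ R1]; rewrite R1; ring. }
rewrite <- D1, <- D2; split.
- replace ((1 - x) * PSeries (PS_derive a) x / (1 - x)) with (PSeries (PS_derive a) x)
    by (field; exact Hx1).
  now apply is_derive_PSeries.
- replace ((1 - x) * PSeries (PS_derive b) x / (1 - x)) with (PSeries (PS_derive b) x)
    by (field; exact Hx1).
  now apply is_derive_PSeries.
Qed.

(* [f = sum_i rho s i x^i] satisfies [(1 - x) f' = s f], hence [(1 - x)^s f] is constant. *)
Lemma binomial_series (s : C) (y : R) : 0 <= y < 1 ->
  is_series (fun i => rho s i * RtoC (y ^ i))%C (Cexp (- s * RtoC (ln (1 - y)))).
Proof.
intros Hy.
set (f1 := PSeries (fun i => Re (rho s i))).
set (f2 := PSeries (fun i => Im (rho s i))).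
assert (Hy1 : Rabs y < 1) by (apply Rabs_def1; lra).
assert (F0 : f1 0 = 1 /\ f2 0 = 0).
{ unfold f1, f2; rewrite !PSeries_0; simpl; unfold Re, Im; simpl; split; ring. }
(* [u + i v] is [(1 - x)^s], and [G] says that its product with [f1 + i f2] is 1 at [y]. *)
set (u := fun x => exp (Re s * ln (1 - x)) * cos (Im s * ln (1 - x))).
set (v := fun x => exp (Re s * ln (1 - x)) * sin (Im s * ln (1 - x))).
assert (G : f1 y * u y - f2 y * v y = 1 /\ f1 y * v y + f2 y * u y = 0).
{ destruct F0 as [F1 F2].
  assert (U0 : u 0 = 1 /\ v 0 = 0).
  { unfold u, v; rewrite Rminus_0_r, ln_1, !Rmult_0_r, exp_0, cos_0, sin_0; split; ring. }
  destruct U0 as [U0 V0].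
  destruct (proj1 Hy) as [Hy0|<-]; [|rewrite F1, F2, U0, V0; split; ring].
  split.
  - transitivity (f1 0 * u 0 - f2 0 * v 0); [|rewrite F1, F2, U0, V0; ring].
    symmetry; apply (eq_is_derive (fun x => f1 x * u x - f2 x * v x) 0 y); [|exact Hy0].
    intros x Hx; destruct (rho_ode s x) as [D1 D2]; [apply Rabs_def1; lra|].
    fold f1 f2 in D1, D2.
    unfold u, v; auto_derive.
    { repeat split; try lra; eexists; eassumption. }
    assert (Q1 : Derive (fun t : R => f1 t) x = _) by exact (is_derive_unique _ _ _ D1).
    assert (Q2 : Derive (fun t : R => f2 t) x = _) by exact (is_derive_unique _ _ _ D2).
    rewrite Q1, Q2.
    change (zero : R) with 0; unfold Rminus; field; lra.
  - transitivity (f1 0 * v 0 + f2 0 * u 0); [|rewrite F1, F2, U0, V0; ring].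
    symmetry; apply (eq_is_derive (fun x => f1 x * v x + f2 x * u x) 0 y); [|exact Hy0].
    intros x Hx; destruct (rho_ode s x) as [D1 D2]; [apply Rabs_def1; lra|].
    fold f1 f2 in D1, D2.
    unfold u, v; auto_derive.
    { repeat split; try lra; eexists; eassumption. }
    assert (Q1 : Derive (fun t : R => f1 t) x = _) by exact (is_derive_unique _ _ _ D1).
    assert (Q2 : Derive (fun t : R => f2 t) x = _) by exact (is_derive_unique _ _ _ D2).
    rewrite Q1, Q2.
    change (zero : R) with 0; unfold Rminus; field; lra. }
assert (E : Cexp (- s * RtoC (ln (1 - y))) = (f1 y, f2 y)).
{ replace (- s * RtoC (ln (1 - y)))%C with (- (s * RtoC (ln (1 - y))))%C by ring.
  rewrite Cexp_opp.
  assert (P : ((f1 y, f2 y) * Cexp (s * RtoC (ln (1 - y))) = 1)%C).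
  { unfold Cexp; rewrite re_scal_r, im_scal_r; unfold u, v in G.
    apply injective_projections; simpl; lra. }
  rewrite <- (Cmult_1_r (/ _)), <- P; field; apply Cexp_neq_0. }
rewrite E; apply is_series_C.
- apply is_series_ext with (fun i => Re (rho s i) * y ^ i); [intros; now rewrite re_scal_r|].
  apply is_pseries_R, PSeries_correct, CV_radius_inside, (CV_radius_rho s); [exact Hy1|].
  intros; apply re_le_Cmod.
- apply is_series_ext with (fun i => Im (rho s i) * y ^ i); [intros; now rewrite im_scal_r|].
  apply is_pseries_R, PSeries_correct, CV_radius_inside, (CV_radius_rho s); [exact Hy1|].
  intros; apply im_le_Cmod.
Qed.

(** * Complex series and powers of integers *)

Fixpoint csum (f : nat -> C) (n : nat) : C :=
  match n with O => RtoC 0 | S n => (csum f n + f n)%C end.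

Lemma csum_ext (f g : nat -> C) (n : nat) :
  (forall k, (k < n)%nat -> f k = g k) -> csum f n = csum g n.
Proof. induction n as [|n IH]; intros H; simpl; [|rewrite IH, H]; auto. Qed.

Lemma csum_plus (f g : nat -> C) (n : nat) :
  csum (fun k => f k + g k)%C n = (csum f n + csum g n)%C.
Proof. induction n as [|n IH]; simpl; [|rewrite IH]; ring. Qed.

Lemma csum_scal (c : C) (f : nat -> C) (n : nat) :
  csum (fun k => c * f k)%C n = (c * csum f n)%C.
Proof. induction n as [|n IH]; simpl; [|rewrite IH]; ring. Qed.

Lemma csum_minus (f g : nat -> C) (n : nat) :
  csum (fun k => f k - g k)%C n = (csum f n - csum g n)%C.
Proof. induction n as [|n IH]; simpl; [|rewrite IH]; ring. Qed.

Lemma csum_split (f : nat -> C) (n m : nat) :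
  csum f (n + m) = (csum f n + csum (fun k => f (n + k)%nat) m)%C.
Proof.
induction m as [|m IH]; [rewrite Nat.add_0_r; simpl; ring|].
rewrite Nat.add_succ_r; simpl; rewrite IH; ring.
Qed.

Lemma csum_S_l (f : nat -> C) (n : nat) :
  csum f (S n) = (f 0%nat + csum (fun k => f (S k)) n)%C.
Proof.
change (S n) with (1 + n)%nat; rewrite csum_split; simpl; ring.
Qed.

Lemma csum_rev (f : nat -> C) (n : nat) :
  csum (fun k => f (n - 1 - k)%nat) n = csum f n.
Proof.
induction n as [|n IH]; [reflexivity|].
rewrite csum_S_l; cbn [csum]; rewrite <- IH, Cplus_comm; f_equal.
- apply csum_ext; intros k Hk; f_equal; lia.
- f_equal; lia.
Qed.

Lemma csum_RtoC (f : nat -> R) (n : nat) :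
  csum (fun k => RtoC (f k)) n = RtoC (rsum f n).
Proof. induction n as [|n IH]; simpl; [reflexivity|]; now rewrite IH, RtoC_plus. Qed.

Lemma Cmod_csum (f : nat -> C) (n : nat) :
  Cmod (csum f n) <= rsum (fun k => Cmod (f k)) n.
Proof.
induction n as [|n IH]; simpl; [rewrite Cmod_0; lra|].
eapply Rle_trans; [apply Cmod_triangle|lra].
Qed.

Lemma sum_n_csum (f : nat -> C) (n : nat) : sum_n f n = csum f (S n).
Proof.
induction n as [|n IH]; [rewrite sum_O; simpl; ring|].
rewrite sum_Sn, IH; reflexivity.
Qed.

Lemma sum_n_rsum (f : nat -> R) (n : nat) : sum_n f n = rsum f (S n).
Proof. now rewrite sum_n_Reals, sum_f_R0_rsum. Qed.

Lemma sum_lt_csum (f : nat -> C) (n : nat) : sum_lt f n = csum f n.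
Proof. destruct n; [reflexivity|apply sum_n_csum]. Qed.

Lemma sum_n_m_csum (f : nat -> C) (a n : nat) :
  sum_n_m f a (a + n) = csum (fun k => f (a + k)%nat) (S n).
Proof.
induction n as [|n IH].
- rewrite Nat.add_0_r, sum_n_n; simpl; rewrite Nat.add_0_r; ring.
- rewrite Nat.add_succ_r, sum_n_Sm, IH by lia; cbn [csum].
  rewrite Nat.add_succ_r; reflexivity.
Qed.

Definition clim (u : nat -> C) (l : C) : Prop :=
  forall eps : R, 0 < eps -> exists N : nat, forall n, (N <= n)%nat -> Cmod (u n - l) < eps.

Lemma clim_const (c : C) : clim (fun _ => c) c.
Proof.
intros eps He; exists 0%nat; intros n _.
replace (c - c)%C with (RtoC 0) by ring; rewrite Cmod_0; exact He.
Qed.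

Lemma clim_ext (u v : nat -> C) (l : C) : (forall n, u n = v n) -> clim u l -> clim v l.
Proof.
intros E H eps He; destruct (H eps He) as [N HN]; exists N; intros n Hn.
rewrite <- E; auto.
Qed.

Lemma clim_plus (u v : nat -> C) (l m : C) :
  clim u l -> clim v m -> clim (fun n => u n + v n)%C (l + m)%C.
Proof.
intros Hu Hv eps He.
destruct (Hu (eps / 2)) as [N1 H1]; [lra|]; destruct (Hv (eps / 2)) as [N2 H2]; [lra|].
exists (max N1 N2); intros n Hn.
specialize (H1 n ltac:(lia)); specialize (H2 n ltac:(lia)).
replace (u n + v n - (l + m))%C with ((u n - l) + (v n - m))%C by ring.
eapply Rle_lt_trans; [apply Cmod_triangle|lra].
Qed.

Lemma clim_scal (c : C) (u : nat -> C) (l : C) :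
  clim u l -> clim (fun n => c * u n)%C (c * l)%C.
Proof.
intros Hu eps He.
assert (P := Cmod_ge_0 c).
destruct (Hu (eps / (Cmod c + 1))) as [N HN]; [apply Rdiv_lt_0_compat; lra|].
exists N; intros n Hn; specialize (HN n Hn).
replace (c * u n - c * l)%C with (c * (u n - l))%C by ring.
rewrite Cmod_mult; apply Rlt_div_r in HN; [|lra].
assert (Q := Cmod_ge_0 (u n - l)); nra.
Qed.

Lemma clim_opp (u : nat -> C) (l : C) : clim u l -> clim (fun n => - u n)%C (- l)%C.
Proof.
intros H eps He; destruct (H eps He) as [N HN]; exists N; intros n Hn.
replace (- u n - - l)%C with (- (u n - l))%C by ring; rewrite Cmod_opp; auto.
Qed.

Lemma clim_minus (u v : nat -> C) (l m : C) :
  clim u l -> clim v m -> clim (fun n => u n - v n)%C (l - m)%C.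
Proof. intros Hu Hv; apply clim_plus; [|apply clim_opp]; assumption. Qed.

Lemma clim_csum (u : nat -> nat -> C) (l : nat -> C) (n : nat) :
  (forall k, (k < n)%nat -> clim (u k) (l k)) ->
  clim (fun i => csum (fun k => u k i) n) (csum l n).
Proof.
induction n as [|n IH]; intros H; simpl; [apply clim_const|].
apply clim_plus; auto.
Qed.

Lemma clim_bound (u : nat -> C) (l : C) (B : R) :
  clim u l -> (forall n, Cmod (u n) <= B) -> Cmod l <= B.
Proof.
intros H HB; apply le_epsilon; intros eps He.
destruct (H eps He) as [N HN]; specialize (HN N (le_n N)).
assert (A := Cmod_triangle_minus l (u N)); rewrite Cmod_minus_sym in A.
specialize (HB N); lra.
Qed.

Lemma clim_unique (u : nat -> C) (l m : C) : clim u l -> clim u m -> l = m.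
Proof.
intros Hl Hm.
assert (E : Cmod (l - m) <= 0).
{ apply (clim_bound (fun n => u n - u n)%C); [now apply clim_minus|].
  intros n; replace (u n - u n)%C with (RtoC 0) by ring; rewrite Cmod_0; lra. }
assert (P := Cmod_ge_0 (l - m)).
replace l with ((l - m) + m)%C by ring.
rewrite (Cmod_eq_0 (l - m)) by lra; ring.
Qed.

Lemma clim_subseq (u : nat -> C) (l : C) (phi : nat -> nat) :
  (forall n, (n <= phi n)%nat) -> clim u l -> clim (fun n => u (phi n)) l.
Proof.
intros Hphi H eps He; destruct (H eps He) as [N HN]; exists N; intros n Hn.
apply HN; specialize (Hphi n); lia.
Qed.

Lemma clim_of_Cmod (u : nat -> C) (v : nat -> R) (l : C) :
  (forall n, Cmod (u n - l) <= v n) -> is_lim_seq v 0 -> clim u l.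
Proof.
intros H Hv eps He.
apply is_lim_seq_spec in Hv.
destruct (Hv (mkposreal eps He)) as [N HN]; exists N; intros n Hn.
specialize (HN n Hn); simpl in HN; rewrite Rminus_0_r in HN.
eapply Rle_lt_trans; [apply H|]; eapply Rle_lt_trans; [apply Rle_abs|exact HN].
Qed.

Lemma is_series_clim (a : nat -> C) (l : C) :
  is_series a l <-> clim (csum a) l.
Proof.
split.
- intros H eps He.
  destruct (H (fun z => Cmod (z - l) < eps)) as [N HN].
  { apply (locally_C l (fun z => Cmod (z - l) < eps)).
    exists (mkposreal eps He); intros z Hz; exact Hz. }
  exists (S N); intros [|n] Hn; [lia|].
  rewrite <- sum_n_csum; apply HN; lia.
- intros H P [eps HP].
  destruct (H eps (cond_pos eps)) as [N HN].
  exists N; intros n Hn; apply HP, C_NormedModule_mixin_compat1.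
  rewrite sum_n_csum; apply HN; lia.
Qed.

Lemma is_series_Cmod_le (a : nat -> C) (l : C) (b : nat -> R) :
  is_series a l -> ex_series b -> (forall k, Cmod (a k) <= b k) -> Cmod l <= Series b.
Proof.
intros Ha Hb Hab; apply is_series_clim in Ha.
apply (clim_bound _ _ _ Ha); intros n.
eapply Rle_trans; [apply Cmod_csum|].
eapply Rle_trans; [apply rsum_le; intros k _; apply Hab|].
assert (Pb : forall k, 0 <= b k) by (intros k; eapply Rle_trans; [apply Cmod_ge_0|apply Hab]).
assert (L := Series_correct b Hb).
apply (is_lim_seq_incr_compare (fun n => rsum b n)).
- apply is_lim_seq_incr_1; apply is_lim_seq_ext with (fun n => sum_n b n); [apply sum_n_rsum|exact L].
- intros k; simpl; specialize (Pb k); lra.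
Qed.

Lemma ex_series_C (a : nat -> C) (b : nat -> R) :
  ex_series b -> (forall k, Cmod (a k) <= b k) -> exists l, is_series a l.
Proof.
intros Hb Hab.
exact (ex_series_le (V := C_CompleteNormedModule) a b Hab Hb).
Qed.

Lemma is_series_geom_C (w : C) : Cmod w < 1 -> is_series (fun k => w ^ k)%C (/ (1 - w))%C.
Proof.
intros Hw.
assert (H1 : (1 - w)%C <> RtoC 0).
{ intros E; assert (E2 : w = RtoC 1) by (replace w with (1 - (1 - w))%C by ring; rewrite E; ring).
  rewrite E2, Cmod_1 in Hw; lra. }
apply is_series_clim.
apply clim_ext with (fun n => / (1 - w) * (1 - w ^ n))%C.
{ intros n; induction n as [|n IH]; [simpl; ring|].
  cbn [csum]; rewrite <- IH, Cpow_S; field; exact H1. }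
assert (L : clim (fun n => 1 - w ^ n)%C 1); [|generalize (clim_scal (/ (1 - w)) _ _ L); now rewrite Cmult_1_r].
apply clim_of_Cmod with (fun n => Cmod w ^ n).
- intros n; replace (1 - w ^ n - 1)%C with (- w ^ n)%C by ring.
  rewrite Cmod_opp, Cmod_pow; lra.
- apply is_lim_seq_geom; rewrite Rabs_pos_eq by apply Cmod_ge_0; exact Hw.
Qed.

(** The bound depends on the majorant alone: wherever one majorant serves, convergence is
    uniform. *)
Lemma is_series_tail_le (a : nat -> C) (l : C) (b : nat -> R) (n : nat) :
  is_series a l -> ex_series b -> (forall k, Cmod (a k) <= b k) ->
  Cmod (l - csum a n) <= Series b - rsum b n.
Proof.
intros Ha Hb Hab.
assert (S1 : is_series (fun i => a (n + i)%nat) (l - csum a n)%C).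
{ apply is_series_clim in Ha; apply is_series_clim.
  apply clim_ext with (fun m => csum a (n + m) - csum a n)%C.
  - intros m; rewrite csum_split; ring.
  - apply clim_minus; [|apply clim_const].
    apply (clim_subseq _ _ (fun m => n + m)%nat); [intros; lia|exact Ha]. }
assert (S2 : is_series (fun i => b (n + i)%nat) (Series b - rsum b n)).
{ destruct n as [|n].
  - simpl; rewrite Rminus_0_r; now apply Series_correct.
  - rewrite (Series_incr_n b (S n)) by (try lia; exact Hb); simpl Init.Nat.pred.
    rewrite sum_f_R0_rsum.
    replace (rsum b (S n) + Series (fun k => b (S n + k)%nat) - rsum b (S n))
      with (Series (fun k => b (S n + k)%nat)) by ring.
    apply Series_correct; now apply (ex_series_incr_n b (S n)). }
rewrite <- (is_series_unique _ _ S2).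
apply (is_series_Cmod_le _ _ _ S1); [eexists; exact S2|intros; apply Hab].
Qed.

Lemma is_lim_seq_rsum (b : nat -> R) : ex_series b -> is_lim_seq (fun n => rsum b n) (Series b).
Proof.
intros Hb; apply is_lim_seq_incr_1; apply is_lim_seq_ext with (fun n => sum_n b n);
  [apply sum_n_rsum|apply (Series_correct b Hb)].
Qed.

Lemma ex_series_scal_R (c : R) (b : nat -> R) : ex_series b -> ex_series (fun k => c * b k).
Proof. exact (ex_series_scal_l (K := R_AbsRing) (V := R_NormedModule) c b). Qed.

(* The domination by a product of two summable sequences makes the double
   series absolutely convergent. *)
Lemma series_interchange (t : nat -> nat -> C) (r c : nat -> C) (al b : nat -> R) (l : C) :
  ex_series al -> ex_series b ->
  (forall k i, Cmod (t k i) <= al k * b i) ->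
  (forall k, is_series (t k) (r k)) -> (forall i, is_series (fun k => t k i) (c i)) ->
  is_series r l -> is_series c l.
Proof.
intros Hal Hb Ht Hr Hc Hl.
apply is_series_clim.
(* The error after [n] columns is estimated by rows: the tail of row [k] is at most [al k] times the
   tail of [b]. *)
apply clim_of_Cmod with (fun n => Series al * (Series b - rsum b n)).
- intros n.
  assert (Tail : forall k, Cmod (r k - csum (t k) n) <= al k * (Series b - rsum b n)).
  { intros k; rewrite Rmult_minus_distr_l, <- Series_scal_l, <- rsum_scal.
    apply is_series_tail_le; [apply Hr|now apply ex_series_scal_R|apply Ht]. }
  assert (S3 : is_series (fun k => r k - csum (t k) n)%C (l - csum c n)%C).
  { apply is_series_clim.
    apply clim_ext with (fun m => csum r m - csum (fun i => csum (fun k => t k i) m) n)%C.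
    - intros m; induction m as [|m IH].
      + simpl; clear; induction n as [|n IH]; simpl; [ring|].
        replace (0 - (csum (fun _ => RtoC 0) n + 0))%C
          with (0 - csum (fun _ => RtoC 0) n)%C by ring; exact IH.
      + cbn [csum]; rewrite csum_plus, <- IH.
        change (csum (fun k => t m k) n) with (csum (t m) n); ring.
    - apply clim_minus; [now apply is_series_clim|].
      apply clim_csum; intros i _; now apply is_series_clim. }
  rewrite Cmod_minus_sym, <- Series_scal_r.
  apply (is_series_Cmod_le _ _ _ S3); [|exact Tail].
  now apply ex_series_scal_r.
- replace (Finite 0) with (Finite (Series al * (Series b - Series b))) by (f_equal; ring).
  apply is_lim_seq_mult'; [apply is_lim_seq_const|].
  apply is_lim_seq_minus'; [apply is_lim_seq_const|now apply is_lim_seq_rsum].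
Qed.

Lemma npow_plus (m : nat) (s t : C) : npow m (s + t) = (npow m s * npow m t)%C.
Proof. unfold npow; rewrite <- Cexp_plus; f_equal; ring. Qed.

Lemma npow_opp (m : nat) (s : C) : npow m (- s) = (/ npow m s)%C.
Proof. unfold npow; rewrite <- Cexp_opp; f_equal; ring. Qed.

Lemma npow_neq_0 (m : nat) (s : C) : npow m s <> RtoC 0.
Proof. apply Cexp_neq_0. Qed.

Lemma Cmod_npow (m : nat) (s : C) : Cmod (npow m s) = exp (Re s * ln (INR m)).
Proof. unfold npow; now rewrite Cmod_Cexp, re_scal_r. Qed.

Lemma npow_mul (a b : nat) (s : C) : (1 <= a)%nat -> (1 <= b)%nat ->
  npow (a * b) s = (npow a s * npow b s)%C.
Proof.
intros Ha Hb; unfold npow; rewrite mult_INR, ln_mult by (apply lt_0_INR; lia).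
rewrite RtoC_plus, <- Cexp_plus; f_equal; ring.
Qed.

Lemma npow_pow (p k : nat) (s : C) : (1 <= p)%nat -> npow (p ^ k) s = (npow p s ^ k)%C.
Proof.
intros Hp; induction k as [|k IH].
- unfold npow; simpl; rewrite ln_1, Cmult_0_r; apply Cexp_0.
- rewrite Nat.pow_succ_r', npow_mul, IH, Cpow_S; [reflexivity|exact Hp|].
  assert (p ^ k <> 0)%nat by (apply Nat.pow_nonzero; lia); lia.
Qed.

Lemma npow_1_exp (m : nat) : (1 <= m)%nat -> npow m 1 = RtoC (INR m).
Proof.
intros Hm; unfold npow; rewrite Cmult_1_l; unfold Cexp; simpl.
rewrite exp_ln, cos_0, sin_0 by (apply lt_0_INR; lia).
apply injective_projections; simpl; ring.
Qed.

Lemma npow_INR_exp (m j : nat) : (1 <= m)%nat -> npow m (RtoC (INR j)) = RtoC (INR m ^ j).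
Proof.
intros Hm; induction j as [|j IH].
- simpl; unfold npow; rewrite Cmult_0_l; apply Cexp_0.
- rewrite S_INR, RtoC_plus, npow_plus, IH, npow_1_exp by exact Hm.
  rewrite <- RtoC_mult; f_equal; simpl; ring.
Qed.

Lemma cdiff_npow (m : nat) (f : C -> C) (z : C) : cdiff f z -> cdiff (fun w => npow m (f w)) z.
Proof.
intros H; apply (cdiff_comp Cexp (fun w => f w * RtoC (ln (INR m)))%C); [|apply cdiff_Cexp].
apply cdiff_mult; [exact H|apply cdiff_const].
Qed.

(** * Expansion of one block *)

(* [is_series_ext] leaves equations typed in [C_NormedModule], which [ring] rejects. *)
Ltac on_C := match goal with |- @eq _ ?x ?y => change (@eq C x y) end.

(** Absorbs the factor [i + 1] of Faulhaber's formula and thereby turns [rho s i] into the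
    coefficient [rho (s - 1) (S i)] of the theorem. *)
Lemma rho_shift (s : C) (i : nat) :
  (RtoC (INR (S i)) * rho (s - 1) (S i) = (s - 1) * rho s i)%C.
Proof.
induction i as [|i IH].
- simpl; field; apply RtoC_neq_0; lra.
- rewrite rho_recurrence.
  replace (s - 1 + RtoC (INR (S i)))%C with (s + RtoC (INR i))%C by (rewrite S_INR, RtoC_plus; ring).
  change (rho s (S i)) with (rho s i * (s + RtoC (INR i)) / RtoC (INR (S i)))%C.
  transitivity (((s - 1) * rho s i) * ((s + RtoC (INR i)) / RtoC (INR (S i))))%C.
  + rewrite <- IH; field; apply RtoC_neq_0, INR_S_neq_0.
  + field; apply RtoC_neq_0, INR_S_neq_0.
Qed.

Lemma bin_absorb (j r : nat) : INR (S r) * bin (S (j + r)) j = INR (S (j + r)) * bin (j + r) j.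
Proof.
assert (A1 := bin_fact (S (j + r)) j ltac:(lia)); assert (A2 := bin_fact (j + r) j ltac:(lia)).
replace (S (j + r) - j)%nat with (S r) in A1 by lia.
replace (j + r - j)%nat with r in A2 by lia.
rewrite !fact_simpl, !mult_INR in A1.
assert (P1 := INR_fact_neq_0 j); assert (P2 := INR_fact_neq_0 r).
apply Rmult_eq_reg_r with (INR (fact j) * INR (fact r)); [|now apply Rmult_integral_contrapositive].
transitivity (bin (S (j + r)) j * (INR (fact j) * (INR (S r) * INR (fact r)))); [ring|].
rewrite A1, <- A2; ring.
Qed.

(** Splits the rising factorial after [j] factors. In [em_term_series] this leaves a binomial series
    with shifted parameter; in [block_term_major] it absorbs the binomial coefficient of
    [btail_bound]. *)
Lemma rho_bin (s : C) (j r : nat) :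
  (rho s (j + r) * RtoC (bin (j + r) j) = rho s j * rho (s + RtoC (INR j)) r)%C.
Proof.
induction r as [|r IH]; [rewrite Nat.add_0_r, bin_diag; simpl; ring|].
rewrite Nat.add_succ_r; cbn [rho].
assert (P1 := RtoC_neq_0 _ (INR_S_neq_0 (j + r))); assert (P2 := RtoC_neq_0 _ (INR_S_neq_0 r)).
assert (B : RtoC (bin (S (j + r)) j)
   = (RtoC (INR (S (j + r))) / RtoC (INR (S r)) * RtoC (bin (j + r) j))%C).
{ assert (A := f_equal RtoC (bin_absorb j r)); rewrite !RtoC_mult in A.
  transitivity ((RtoC (INR (S r)) * RtoC (bin (S (j + r)) j)) / RtoC (INR (S r)))%C; [field; exact P2|].
  rewrite A; field; exact P2. }
rewrite B.
transitivity ((rho s (j + r) * RtoC (bin (j + r) j)) * ((s + RtoC (INR (j + r))) / RtoC (INR (S r))))%C.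
{ field; split; assumption. }
rewrite IH, plus_INR, RtoC_plus; field; exact P2.
Qed.

Lemma falling_S (z : C) (r : nat) : falling (z + 1) (S r) = ((z + 1) * falling z r)%C.
Proof.
induction r as [|r IH]; [simpl; ring|].
change (falling (z + 1) (S (S r))) with (falling (z + 1) (S r) * (z + 1 - RtoC (INR (S r))))%C.
rewrite IH, S_INR, RtoC_plus; simpl; ring.
Qed.

(** The falling factorial from [s + r - 1] has the factors of the rising factorial of [s] in reverse
    order. *)
Lemma Cbinom_rho (s : C) (r : nat) : Cbinom (s + RtoC (INR r) - 1) r = rho s r.
Proof.
unfold Cbinom.
assert (P := RtoC_neq_0 _ (INR_fact_neq_0 r)).
enough (E : falling (s + RtoC (INR r) - 1) r = (rho s r * RtoC (INR (fact r)))%C)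
  by (rewrite E; field; exact P).
clear P; induction r as [|r IH]; [simpl; ring|].
replace (s + RtoC (INR (S r)) - 1)%C with ((s + RtoC (INR r) - 1) + 1)%C
  by (rewrite S_INR, RtoC_plus; ring).
rewrite falling_S, IH, fact_simpl, mult_INR, RtoC_mult; cbn [rho].
field; apply RtoC_neq_0, INR_S_neq_0.
Qed.

Lemma is_series_scal_C (c : C) (a : nat -> C) (l : C) :
  is_series a l -> is_series (fun k => c * a k)%C (c * l)%C.
Proof. exact (is_series_scal (K := C_AbsRing) (V := C_NormedModule) c a l). Qed.

Lemma is_series_csum (u : nat -> nat -> C) (l : nat -> C) (n : nat) :
  (forall k, (k < n)%nat -> is_series (u k) (l k)) ->
  is_series (fun i => csum (fun k => u k i) n) (csum l n).
Proof.
intros H; apply is_series_clim.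
apply clim_ext with (fun i => csum (fun k => csum (u k) i) n).
- intros i; induction i as [|i IH].
  + simpl; clear; induction n as [|n IH]; simpl; [reflexivity|rewrite IH; ring].
  + cbn [csum]; rewrite csum_plus, IH; reflexivity.
- apply clim_csum; intros k Hk; now apply is_series_clim, H.
Qed.

Lemma is_series_minus_C (a b : nat -> C) (l m : C) :
  is_series a l -> is_series b m -> is_series (fun k => a k - b k)%C (l - m)%C.
Proof. exact (is_series_minus (K := C_AbsRing) (V := C_NormedModule) a b l m). Qed.

Lemma is_series_incr_1_C (a : nat -> C) (l : C) :
  is_series a l -> is_series (fun k => a (S k)) (l - a 0%nat)%C.
Proof.
intros H; apply (is_series_incr_1 a).
change (is_series a (l - a 0%nat + a 0%nat)%C).
now replace (l - a 0%nat + a 0%nat)%C with l by ring.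
Qed.

Section Block.

Variables (s : C) (N M : nat).
Hypothesis HN : (1 <= N)%nat.

Let P := (N + M)%nat.
Let x := INR M / INR P.

(** The contribution of order [i] of the binomial expansion to [s - 1] times the sum over the block
    [(N, P]], without its Bernoulli terms [j < D]. *)
Definition block_term (D i : nat) : C :=
  (rho (s - 1) (S i) * npow P (- s) * RtoC (btail D i (INR M) / INR P ^ i))%C.

(** [em_coef j * em_pow m j] is [s - 1] times the Euler-Maclaurin term of order [j] at [m], as in
    the second sum of the theorem for [m = n]. *)
Definition em_coef (j : nat) : C := (rho (s - 1) j * RtoC (bernoulli j))%C.

Definition em_pow (m j : nat) : C := npow m (1 - s - RtoC (INR j)).

Lemma block_pos : 0 < INR P /\ 0 < INR N.
Proof. split; apply lt_0_INR; unfold P; lia. Qed.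

Lemma npow_ratio (m : nat) (z : C) : (m < P)%nat ->
  (npow P z * Cexp (z * RtoC (ln (1 - INR m / INR P))) = npow (P - m) z)%C.
Proof.
intros Hm; destruct block_pos as [HP _].
unfold npow; rewrite <- Cexp_plus; f_equal.
assert (Q : 0 < INR (P - m)) by (apply lt_0_INR; lia).
replace (1 - INR m / INR P) with (INR (P - m) * / INR P)
  by (rewrite minus_INR by lia; field; lra).
rewrite ln_mult, ln_Rinv by (try apply Rinv_0_lt_compat; assumption).
rewrite RtoC_plus, RtoC_opp; ring.
Qed.

(** The integers of the block are [P - m] with [m < M]. The point [m = 0] is included, so the
    convention [0^0 = 1] matters both here and in [faulhaber]. *)
Lemma block_series_0 :
  is_series (block_term 0) ((s - 1) * csum (fun m => npow (P - m) (- s)) M)%C.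
Proof.
destruct block_pos as [HP _].
rewrite <- csum_scal.
apply is_series_ext with
  (fun i => csum (fun m => (s - 1) * npow P (- s) * (rho s i * RtoC ((INR m / INR P) ^ i)%R))%C M).
- intros i; on_C; rewrite csum_scal, csum_scal, csum_RtoC.
  rewrite (rsum_ext _ (fun m => / INR P ^ i * INR m ^ i)), rsum_scal.
  2:{ intros m _; unfold Rdiv; rewrite Rpow_mult_distr, pow_inv; ring. }
  unfold block_term, btail; rewrite faulhaber.
  replace (bsum (S i) 0 (INR M)) with 0 by reflexivity.
  replace ((INR (S i) * rsum (fun m => INR m ^ i) M - 0) / INR P ^ i)
    with (INR (S i) * (/ INR P ^ i * rsum (fun m => INR m ^ i) M))
    by (field; apply pow_nonzero; lra).
  rewrite (RtoC_mult (INR (S i))).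
  transitivity (((s - 1) * rho s i) * (npow P (- s) * RtoC (/ INR P ^ i * rsum (fun m => INR m ^ i) M)%R))%C;
    [ring|].
  rewrite <- rho_shift; ring.
- apply is_series_csum; intros m Hm.
  rewrite <- (npow_ratio m (- s)) by (unfold P; lia).
  rewrite Cmult_assoc; apply is_series_scal_C.
  apply binomial_series; split.
  + apply Rdiv_le_0_compat; [apply pos_INR|exact HP].
  + apply Rlt_div_l; [exact HP|]; rewrite Rmult_1_l; apply lt_INR; unfold P; lia.
Qed.

(** For fixed [j], [rho_bin] turns the sum over [i = j + l] into the binomial series of parameter
    [z] at [x]. Its powers start at [x^1]; the missing constant term produces [- em_pow P j], while
    [P * (1 - x) = N] produces [em_pow N j]. *)
Lemma em_term_series (j : nat) :
  is_series (fun l => rho (s - 1) (S (j + l)) * npow P (- s)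
      * RtoC (bin (S (j + l)) j * bernoulli j * INR M ^ (S (j + l) - j) / INR P ^ (j + l)))%C
    (em_coef j * (em_pow N j - em_pow P j))%C.
Proof.
destruct block_pos as [HP HN0].
assert (Hx : 0 <= x < 1).
{ unfold x; split; [apply Rdiv_le_0_compat; [apply pos_INR|exact HP]|].
  apply Rlt_div_l; [exact HP|]; rewrite Rmult_1_l; apply lt_INR; unfold P; lia. }
set (z := (s - 1 + RtoC (INR j))%C).
assert (E : is_series (fun l => rho z (S l) * RtoC (x ^ S l))%C
              (Cexp (- z * RtoC (ln (1 - x))) - 1)%C).
{ generalize (is_series_incr_1_C _ _ (binomial_series z x Hx)).
  simpl (rho z 0); simpl (x ^ 0); now rewrite Cmult_1_l. }
apply (is_series_scal_C (em_coef j * em_pow P j)%C) in E.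
assert (EP : em_pow P j = (npow P (- s) * RtoC (INR P * / INR P ^ j))%C).
{ unfold em_pow; replace (1 - s - RtoC (INR j))%C with (- s + (1 + - RtoC (INR j)))%C by ring.
  rewrite npow_plus, npow_plus, (npow_opp P (RtoC (INR j))), npow_1_exp, npow_INR_exp by (unfold P; lia).
  rewrite RtoC_mult, RtoC_inv by (apply pow_nonzero; lra); ring. }
replace (em_coef j * (em_pow N j - em_pow P j))%C
  with (em_coef j * em_pow P j * (Cexp (- z * RtoC (ln (1 - x))) - 1))%C.
- revert E; apply is_series_ext; intros l; on_C.
  replace (S (j + l) - j)%nat with (S l) by lia.
  replace (bin (S (j + l)) j * bernoulli j * INR M ^ S l / INR P ^ (j + l))
    with (bin (j + S l) j * bernoulli j * (INR P * / INR P ^ j * x ^ S l)).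
  2:{ rewrite Nat.add_succ_r; unfold x, Rdiv; rewrite Rpow_mult_distr, pow_inv, pow_add.
      simpl; field; repeat split; try apply pow_nonzero; lra. }
  rewrite <- Nat.add_succ_r, EP; unfold em_coef.
  rewrite !RtoC_mult.
  transitivity (rho (s - 1) j * rho z (S l) * RtoC (bernoulli j) * npow P (- s)
     * (RtoC (INR P) * RtoC (/ INR P ^ j) * RtoC (x ^ S l)))%C; [ring|].
  unfold z; rewrite <- rho_bin; ring.
- replace (em_pow N j) with (em_pow P j * Cexp (- z * RtoC (ln (1 - x))))%C; [ring|].
  unfold em_pow; replace (1 - s - RtoC (INR j))%C with (- z)%C by (unfold z; ring).
  unfold x; rewrite (npow_ratio M) by (unfold P; lia); f_equal; unfold P; lia.
Qed.

(* The terms with [j = D] of all [block_term D i] sum to a telescoping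
   difference; what is left is the series for [D + 1]. *)
Lemma block_series (D : nat) :
  is_series (fun l => block_term D (D + l))
    ((s - 1) * csum (fun m => npow (P - m) (- s)) M
     - csum (fun j => em_coef j * (em_pow N j - em_pow P j)) D)%C.
Proof.
induction D as [|D IH].
- simpl csum at 2; replace ((s - 1) * csum (fun m => npow (P - m) (- s)) M - 0)%C
    with ((s - 1) * csum (fun m => npow (P - m) (- s)) M)%C by ring.
  exact block_series_0.
- set (a := fun l => block_term (S D) (D + l)).
  assert (A : is_series a
    ((s - 1) * csum (fun m => npow (P - m) (- s)) M
     - csum (fun j => em_coef j * (em_pow N j - em_pow P j)) (S D))%C).
  { replace ((s - 1) * csum (fun m => npow (P - m) (- s)) M
       - csum (fun j => em_coef j * (em_pow N j - em_pow P j)) (S D))%C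
      with ((s - 1) * csum (fun m => npow (P - m) (- s)) M
       - csum (fun j => em_coef j * (em_pow N j - em_pow P j)) D
       - em_coef D * (em_pow N D - em_pow P D))%C by (simpl; ring).
    generalize (is_series_minus_C _ _ _ _ IH (em_term_series D)); apply is_series_ext.
    intros l; on_C; unfold a, block_term; rewrite (btail_succ D (D + l)).
    unfold Rdiv; rewrite Rmult_plus_distr_r, RtoC_plus; ring. }
  apply is_series_incr_1_C in A.
  (* At order [i = D] no index with [D + 1 <= j <= i] is left, so the series may start at
     [i = D + 1]. *)
  assert (A0 : a 0%nat = RtoC 0).
  { unfold a, block_term; rewrite Nat.add_0_r, btail_diag; unfold Rdiv; rewrite Rmult_0_l; ring. }
  unfold Cminus in A at 1; rewrite A0, Copp_0, Cplus_0_r in A.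
  revert A; apply is_series_ext; intros l; unfold a; f_equal; lia.
Qed.

End Block.

(** * Summation over the blocks *)

Lemma cdiff_csum (f : nat -> C -> C) (z : C) (n : nat) :
  (forall k, (k < n)%nat -> cdiff (f k) z) -> cdiff (fun w => csum (fun k => f k w) n) z.
Proof.
induction n as [|n IH]; intros H; simpl; [apply cdiff_const|].
apply cdiff_plus; auto.
Qed.

Lemma cdiff_rho (f : C -> C) (z : C) (i : nat) : cdiff f z -> cdiff (fun w => rho (f w) i) z.
Proof.
intros Hf; induction i as [|i IH]; cbn [rho]; [apply cdiff_const|].
apply cdiff_mult; [|apply cdiff_const].
apply cdiff_mult; [exact IH|].
apply cdiff_plus; [exact Hf|apply cdiff_const].
Qed.

(** The power [p^(1 - s - j)] is both the ratio of the geometric series over the blocks and the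
    quotient of the two powers in the denominator. *)
Lemma npow_gap (p j : nat) (s : C) : (2 <= p)%nat -> 1 - INR j < Re s ->
  Cmod (npow p (1 - s - RtoC (INR j))) < 1 /\
  (npow p s - npow p (1 - RtoC (INR j)))%C <> RtoC 0.
Proof.
intros Hp Hs.
assert (L : 0 < ln (INR p)).
{ rewrite <- ln_1; apply ln_increasing; [lra|]; apply (lt_INR 1); lia. }
assert (Q : Cmod (npow p (1 - s - RtoC (INR j))) < 1).
{ rewrite Cmod_npow; apply Rlt_le_trans with (exp 0); [|rewrite exp_0; lra].
  apply exp_increasing.
  replace (Re (1 - s - RtoC (INR j))) with (1 - Re s - INR j) by (simpl; unfold Re; ring).
  assert (0 < (Re s - (1 - INR j)) * ln (INR p)) by (apply Rmult_lt_0_compat; lra).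
  lra. }
split; [exact Q|].
intros E.
replace (1 - RtoC (INR j))%C with ((1 - s - RtoC (INR j)) + s)%C in E by ring.
rewrite npow_plus in E.
assert (E2 : npow p (1 - s - RtoC (INR j)) = RtoC 1).
{ assert (E3 : ((1 - npow p (1 - s - RtoC (INR j))) * npow p s = 0)%C) by (rewrite <- E; ring).
  replace (npow p (1 - s - RtoC (INR j)))
    with (1 - ((1 - npow p (1 - s - RtoC (INR j))) * npow p s) / npow p s)%C
    by (field; apply npow_neq_0).
  rewrite E3; field; apply npow_neq_0. }
rewrite E2, Cmod_1 in Q; lra.
Qed.

Lemma exp_INR_mult (k : nat) (x : R) : exp (INR k * x) = exp x ^ k.
Proof.
induction k as [|k IH]; [simpl; now rewrite Rmult_0_l, exp_0|].
rewrite S_INR, Rmult_plus_distr_r, exp_plus, IH, Rmult_1_l; simpl; ring.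
Qed.

Section Blocks.

Variables (n p D : nat).
Hypotheses (Hn : (1 <= n)%nat) (Hp : (2 <= p)%nat).

Definition lo (k : nat) : nat := (n * p ^ k)%nat.
Definition len (k : nat) : nat := (n * p ^ k * (p - 1))%nat.

Lemma pow_ge_1 (k : nat) : (1 <= p ^ k)%nat.
Proof. assert (p ^ k <> 0)%nat by (apply Nat.pow_nonzero; lia); lia. Qed.

Lemma lo_pos (k : nat) : (1 <= lo k)%nat.
Proof. assert (A := pow_ge_1 k); unfold lo; nia. Qed.

Lemma lo_len (k : nat) : (lo k + len k = lo (S k))%nat.
Proof. unfold lo, len; rewrite Nat.pow_succ_r'; nia. Qed.

Lemma npow_lo (k : nat) (z : C) : npow (lo k) z = (npow n z * npow p z ^ k)%C.
Proof.
assert (A := pow_ge_1 k); unfold lo; rewrite npow_mul, npow_pow by lia; reflexivity.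
Qed.

Definition inner (s : C) (i : nat) (j : nat) : C :=
  (RtoC (bin (S i) j) * RtoC (bernoulli j)
   * (RtoC (INR (n * (p - 1))) ^ (S i - j) / (npow p s - npow p (1 - RtoC (INR j)))))%C.

(** [npow n (- s)] times the term [i = D + l] of the theorem's series, which makes it the exact
    column sum over the blocks. *)
Definition tau (s : C) (l : nat) : C :=
  (npow n (- s) * (rho (s - 1) (S (D + l)) / RtoC (INR (n * p)) ^ (D + l)
    * csum (fun k => inner s (D + l) (D + k)) (S l)))%C.

Lemma btail_rsum (l : nat) (x : R) :
  btail D (D + l) x =
  rsum (fun k => bin (S (D + l)) (D + k) * bernoulli (D + k) * x ^ (S (D + l) - (D + k))) (S l).
Proof.
assert (E : forall f, rsum f (S (D + l)) = rsum f D + rsum (fun k => f (D + k)%nat) (S l))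
  by (intros f; rewrite <- rsum_split; f_equal; lia).
unfold btail, bsum; rewrite E; ring.
Qed.

(** In the quotient of powers the factors [p^k] combine to [p^(k (1 - j))], independently of [i];
    with [p^(- k s)] this is a geometric series of ratio [w = p^(1 - s - j)], and
    [p^(- s) / (1 - w)] is the reciprocal of [p^s - p^(1 - j)]. *)
Lemma geometric_column (s : C) (i j : nat) : (j <= i)%nat -> 1 - INR j < Re s ->
  is_series (fun k => npow (lo (S k)) (- s) * RtoC (INR (len k) ^ (S i - j) / INR (lo (S k)) ^ i))%C
    (npow n (- s) * (/ RtoC (INR (n * p)) ^ i
      * (RtoC (INR (n * (p - 1))) ^ (S i - j) / (npow p s - npow p (1 - RtoC (INR j))))))%C.
Proof.
intros Hj Hs; destruct (npow_gap p j s Hp Hs) as [G1 G2].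
assert (Pn : 0 < INR n) by (apply lt_0_INR; lia).
assert (Pp : 0 < INR p) by (apply lt_0_INR; lia).
set (w := npow p (1 - s - RtoC (INR j))) in *.
assert (Ew : w = (npow p (- s) * RtoC (INR p / INR p ^ j))%C).
{ unfold w; replace (1 - s - RtoC (INR j))%C with (- s + (1 + - RtoC (INR j)))%C by ring.
  rewrite npow_plus, npow_plus, (npow_opp p (RtoC (INR j))), npow_1_exp, npow_INR_exp by lia.
  unfold Rdiv; rewrite RtoC_mult, RtoC_inv by (apply pow_nonzero; lra); ring. }
assert (Ew2 : npow p (1 - RtoC (INR j)) = (w * npow p s)%C).
{ unfold w; rewrite <- npow_plus; f_equal; ring. }
assert (Nw : (1 - w)%C <> RtoC 0).
{ intros E; apply G2; rewrite Ew2.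
  transitivity ((1 - w) * npow p s)%C; [ring|]; rewrite E; ring. }
set (cst := (npow n (- s) * (/ RtoC (INR (n * p)) ^ i * RtoC (INR (n * (p - 1))) ^ (S i - j)
   * npow p (- s)))%C).
replace (npow n (- s) * _)%C with (cst * / (1 - w))%C.
2:{ unfold cst; rewrite Ew2, npow_opp; unfold Cdiv.
    replace (npow p s - w * npow p s)%C with ((1 - w) * npow p s)%C by ring.
    rewrite (npow_opp p s).
    field; repeat split; try apply npow_neq_0; try exact Nw.
    apply Cpow_nz, RtoC_neq_0, not_0_INR; nia. }
generalize (is_series_scal_C cst _ _ (is_series_geom_C w G1)); apply is_series_ext.
intros k; on_C; unfold cst.
rewrite npow_lo, Cpow_S, <- RtoC_pow, <- RtoC_pow, <- RtoC_inv by (apply pow_nonzero, not_0_INR; nia).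
rewrite Ew, Cpow_mult_l, <- RtoC_pow.
assert (Q : INR (len k) ^ (S i - j) / INR (lo (S k)) ^ i =
  / INR (n * p) ^ i * INR (n * (p - 1)) ^ (S i - j) * (INR p / INR p ^ j) ^ k).
{ unfold len, lo; rewrite <- Nat.mul_assoc, (Nat.mul_comm (p ^ k)), Nat.mul_assoc.
  rewrite Nat.pow_succ_r', Nat.mul_assoc.
  rewrite (mult_INR (n * (p - 1))), (mult_INR (n * p)), !pow_INR, !Rpow_mult_distr.
  assert (E : (INR p ^ k) ^ (S i - j) = (INR p ^ k) ^ i * (INR p / INR p ^ j) ^ k).
  { rewrite Rdiv_def, Rpow_mult_distr, pow_inv, <- !pow_mult.
    replace (k * i)%nat with (k * (i - j) + j * k)%nat by nia.
    replace (k * (S i - j))%nat with (k * (i - j) + k)%nat by nia.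
    rewrite !pow_add; field; apply pow_nonzero; lra. }
  rewrite E; field; repeat split; apply pow_nonzero; try apply pow_nonzero; try lra.
  apply not_0_INR; nia. }
rewrite Q, !RtoC_mult; ring.
Qed.

Lemma tau_series (s : C) (l : nat) : 1 - INR D < Re s ->
  is_series (fun k => block_term s (lo k) (len k) D (D + l)) (tau s l).
Proof.
intros Hs.
set (f := fun j k => (npow (lo (S k)) (- s)
  * RtoC (INR (len k) ^ (S (D + l) - j) / INR (lo (S k)) ^ (D + l)))%C).
set (g := fun j => (npow n (- s) * (/ RtoC (INR (n * p)) ^ (D + l)
      * (RtoC (INR (n * (p - 1))) ^ (S (D + l) - j) / (npow p s - npow p (1 - RtoC (INR j))))))%C).
assert (E : is_series
  (fun k => rho (s - 1) (S (D + l)) * csum (fun j => RtoC (bin (S (D + l)) (D + j) * bernoulli (D + j)) * f (D + j)%nat k) (S l))%C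
  (rho (s - 1) (S (D + l)) * csum (fun j => RtoC (bin (S (D + l)) (D + j) * bernoulli (D + j)) * g (D + j)%nat) (S l))%C).
{ apply is_series_scal_C.
  apply (is_series_csum (fun j k => RtoC (bin (S (D + l)) (D + j) * bernoulli (D + j)) * f (D + j)%nat k)%C).
  intros j Hj; apply is_series_scal_C, geometric_column; [lia|].
  rewrite plus_INR; assert (A := pos_INR j); lra. }
replace (tau s l) with (rho (s - 1) (S (D + l)) * csum (fun j => RtoC (bin (S (D + l)) (D + j) * bernoulli (D + j)) * g (D + j)%nat) (S l))%C.
- revert E; apply is_series_ext; intros k; on_C.
  unfold block_term; rewrite lo_len, btail_rsum.
  rewrite Rdiv_def, Rmult_comm, <- rsum_scal, <- csum_RtoC, <- !Cmult_assoc.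
  f_equal; rewrite <- csum_scal; apply csum_ext; intros j Hj; unfold f, Rdiv; rewrite !RtoC_mult; ring.
- unfold tau, Cdiv; rewrite <- !Cmult_assoc.
  transitivity (rho (s - 1) (S (D + l)) * ((npow n (- s) * / RtoC (INR (n * p)) ^ (D + l))
     * csum (fun k => inner s (D + l) (D + k)) (S l)))%C; [|ring].
  f_equal; rewrite <- csum_scal; apply csum_ext; intros j Hj.
  unfold g, inner; rewrite RtoC_mult; ring.
Qed.

(** This is [P^(1 - D - s1)] for the right end [P = lo (S k)] of block [k], written as a geometric
    sequence. *)
Definition row_major (s1 : R) (k : nat) : R :=
  exp ((1 - INR D - s1) * ln (INR (n * p))) * exp ((1 - INR D - s1) * ln (INR p)) ^ k.

(** [(p - 1) / p] is [len k / lo (S k)] for every [k]; the two [rho] factors are the two sides of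
    the split by [rho_bin] after [S D] factors. *)
Definition col_major (A : R) (l : nat) : R :=
  bern_const D * Cmod (rho (RtoC A) (S D))
  * (INR (p - 1) / INR p * (Cmod (rho (RtoC (A + INR (S D))) l) * (INR (p - 1) / INR p) ^ l)).

Lemma ex_series_row_major (s1 : R) : 1 - INR D < s1 -> ex_series (row_major s1).
Proof.
intros Hs; apply ex_series_scal_R, ex_series_geom.
rewrite Rabs_pos_eq by (left; apply exp_pos).
apply Rlt_le_trans with (exp 0); [|rewrite exp_0; lra].
apply exp_increasing.
assert (L : 0 < ln (INR p)).
{ rewrite <- ln_1; apply ln_increasing; [lra|]; apply (lt_INR 1); lia. }
nra.
Qed.

Lemma ex_series_col_major (A : R) : 0 < A -> ex_series (col_major A).
Proof.
intros HA; apply ex_series_scal_R, ex_series_scal_R, ex_series_rho.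
- assert (P := pos_INR (S D)); lra.
- assert (Pp : 0 < INR p) by (apply lt_0_INR; lia).
  assert (Pq : 0 < INR (p - 1)) by (apply lt_0_INR; lia).
  split; [now apply Rdiv_lt_0_compat|].
  apply Rlt_div_l; [exact Pp|]; rewrite Rmult_1_l; apply lt_INR; lia.
Qed.

(** The bounds [s1] and [A] replace [s] so that the same majorant holds on a whole disc, as
    [head_tau] requires. *)
Lemma block_term_major (s : C) (s1 A : R) (k l : nat) :
  s1 <= Re s -> 0 < A -> Cmod (s - 1) <= A ->
  Cmod (block_term s (lo k) (len k) D (D + l)) <= row_major s1 k * col_major A l.
Proof.
intros Hs HA HsA.
assert (Pp : 0 < INR p) by (apply lt_0_INR; lia).
assert (PP : 1 <= INR (lo (S k))) by (apply (le_INR 1), lo_pos).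
set (P := INR (lo (S k))) in *.
set (x := INR (p - 1) / INR p).
assert (EM : INR (len k) = x * P).
{ unfold x, P, len, lo; rewrite Nat.pow_succ_r', !mult_INR; field; lra. }
assert (Hx : 0 <= x) by (apply Rdiv_le_0_compat; [apply pos_INR|exact Pp]).
unfold block_term; rewrite lo_len; fold P.
rewrite !Cmod_mult, Cmod_npow, Cmod_R.
assert (Pi : 0 < P ^ (D + l)) by (apply pow_lt; lra).
rewrite Rabs_div, (Rabs_pos_eq (P ^ _)) by lra.
assert (T1 := Cmod_rho_le (s - 1) A (S (D + l)) HA HsA).
assert (T2 : exp (Re (- s) * ln P) <= exp (- s1 * ln P)).
{ apply exp_le_compat; simpl; fold (Re s).
  assert (L : 0 <= ln P).
  { rewrite <- ln_1; destruct PP as [PP|<-]; [left; apply ln_increasing; lra|right; reflexivity]. }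
  nra. }
assert (T3 := btail_bound D (D + l) (len k) ltac:(lia)).
rewrite EM in T3 |- *.
replace (S (D + l) - D)%nat with (S l) in T3 by lia.
apply Rle_trans with (Cmod (rho (RtoC A) (S (D + l))) * exp (- s1 * ln P)
  * (bern_const D * bin (S (D + l)) (S D) * (x * P) ^ S l / P ^ (D + l))).
{ apply Rmult_le_compat.
  - apply Rmult_le_pos; [apply Cmod_ge_0|left; apply exp_pos].
  - apply Rdiv_le_0_compat; [apply Rabs_pos|exact Pi].
  - apply Rmult_le_compat; [apply Cmod_ge_0|left; apply exp_pos|exact T1|exact T2].
  - apply Rmult_le_compat_r; [left; now apply Rinv_0_lt_compat|exact T3]. }
assert (RB : Cmod (rho (RtoC A) (S (D + l))) * bin (S (D + l)) (S D)
   = Cmod (rho (RtoC A) (S D)) * Cmod (rho (RtoC (A + INR (S D))) l)).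
{ rewrite RtoC_plus, <- Cmod_mult, <- rho_bin, Cmod_mult, Cmod_R.
  change (S D + l)%nat with (S (D + l)).
  rewrite (Rabs_pos_eq (bin _ _)) by apply bin_nonneg; reflexivity. }
assert (EP : exp (- s1 * ln P) * (P / P ^ D) = row_major s1 k).
{ unfold row_major.
  assert (LP : ln P = ln (INR (n * p)) + INR k * ln (INR p)).
  { unfold P, lo; rewrite Nat.pow_succ_r', Nat.mul_assoc, mult_INR, pow_INR, ln_mult, ln_pow;
      [reflexivity|exact Pp|apply lt_0_INR; nia|now apply pow_lt]. }
  assert (EQ : P / P ^ D = exp ((1 - INR D) * ln P)).
  { unfold Rminus; rewrite Rmult_plus_distr_r, exp_plus, Rmult_1_l, exp_ln by lra.
    unfold Rdiv; f_equal; rewrite Ropp_mult_distr_l_reverse, exp_Ropp; f_equal.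
    rewrite <- ln_pow, exp_ln by (try apply pow_lt; lra); reflexivity. }
  rewrite EQ, <- exp_plus, LP, <- exp_INR_mult, <- exp_plus; f_equal; ring. }
right; rewrite <- EP; unfold col_major; fold x.
rewrite Rpow_mult_distr, pow_add.
transitivity (bern_const D * (Cmod (rho (RtoC A) (S (D + l))) * bin (S (D + l)) (S D))
  * exp (- s1 * ln P) * (x * x ^ l) * (P / P ^ D)).
- simpl; field; split; apply pow_nonzero; lra.
- rewrite RB; ring.
Qed.

Lemma tau_major (s : C) (s1 A : R) (l : nat) :
  1 - INR D < s1 -> s1 <= Re s -> 0 < A -> Cmod (s - 1) <= A ->
  Cmod (tau s l) <= Series (row_major s1) * col_major A l.
Proof.
intros H1 Hs HA HsA; rewrite <- Series_scal_r.
apply (is_series_Cmod_le _ _ _ (tau_series s l ltac:(lra))).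
- now apply ex_series_scal_r, ex_series_row_major.
- intros k; now apply block_term_major.
Qed.

Definition dsum (s : C) (m : nat) : C := csum (fun k => npow (S k) (- s)) m.

Lemma dsum_block (s : C) (k : nat) :
  csum (fun m => npow (lo k + len k - m) (- s)) (len k) = (dsum s (lo (S k)) - dsum s (lo k))%C.
Proof.
unfold dsum; rewrite <- lo_len, csum_split.
rewrite <- (csum_rev (fun m => npow (S (lo k + m)) (- s))).
replace (csum (fun m => npow (lo k + len k - m) (- s)) (len k))
  with (csum (fun m => npow (S (lo k + (len k - 1 - m))) (- s)) (len k)); [ring|].
apply csum_ext; intros m Hm; f_equal; lia.
Qed.

(** Both parts telescope. Along [lo K] the Dirichlet sums tend to [zeta s] and the powers
    [em_pow s (lo K) j] tend to 0; for [j = 0] the latter already requires [1 < Re s]. *)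
Lemma blocks_total (zeta : C -> C) (s : C) : is_zeta zeta -> 1 < Re s ->
  is_series (fun k => (s - 1) * csum (fun m => npow (lo k + len k - m) (- s)) (len k)
     - csum (fun j => em_coef s j * (em_pow s (lo k) j - em_pow s (lo k + len k) j)) D)%C
   ((s - 1) * (zeta s - dsum s n) - csum (fun j => em_coef s j * em_pow s n j) D)%C.
Proof.
intros [Hz _] Hs; apply is_series_clim.
assert (L0 : lo 0 = n) by (unfold lo; simpl; lia).
apply clim_ext with (fun K => (s - 1) * (dsum s (lo K) - dsum s n)
  - (csum (fun j => em_coef s j * em_pow s n j) D - csum (fun j => em_coef s j * em_pow s (lo K) j) D))%C.
- intros K; induction K as [|K IH].
  + rewrite L0; simpl; ring.
  + cbn [csum]; rewrite <- IH, dsum_block, lo_len.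
    rewrite (csum_ext (fun j => em_coef s j * (em_pow s (lo K) j - em_pow s (lo (S K)) j))%C
      (fun j => em_coef s j * em_pow s (lo K) j - em_coef s j * em_pow s (lo (S K)) j)%C)
      by (intros; ring).
    rewrite csum_minus; ring.
- apply clim_minus.
  + apply clim_scal, clim_minus; [|apply clim_const].
    apply (clim_subseq (dsum s) _ lo).
    { intros K; unfold lo; assert (A := Nat.pow_gt_lin_r p K ltac:(lia)); nia. }
    specialize (Hz s Hs); apply is_series_clim in Hz.
    revert Hz; apply clim_ext; intros m; unfold dsum; apply csum_ext; intros; now rewrite npow_opp.
  + assert (Z : clim (fun K => csum (fun j => em_coef s j * em_pow s (lo K) j)%C D)
                  (csum (fun j => em_coef s j * 0)%C D)).
    2:{ generalize (clim_minus _ _ _ _ (clim_const (csum (fun j => em_coef s j * em_pow s n j)%C D)) Z).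
        rewrite (csum_ext (fun j => em_coef s j * 0)%C (fun _ => 0 * 0)%C) by (intros; ring).
        rewrite csum_scal, Cmult_0_l; unfold Cminus at 2; now rewrite Copp_0, Cplus_0_r. }
    apply (clim_csum (fun j K => em_coef s j * em_pow s (lo K) j)%C); intros j _.
    apply clim_scal.
    set (w := npow p (1 - s - RtoC (INR j))).
    set (c := npow n (1 - s - RtoC (INR j))).
    assert (Hw : Cmod w < 1) by (apply npow_gap; [exact Hp|]; assert (A := pos_INR j); lra).
    apply clim_of_Cmod with (fun K => Cmod c * Cmod w ^ K).
    * intros K; unfold em_pow; rewrite npow_lo; fold w c.
      replace (c * w ^ K - 0)%C with (c * w ^ K)%C by ring.
      rewrite Cmod_mult, Cmod_pow; lra.
    * replace (Finite 0) with (Finite (Cmod c * 0)) by (f_equal; ring).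
      apply is_lim_seq_mult'; [apply is_lim_seq_const|].
      apply is_lim_seq_geom; rewrite Rabs_pos_eq by apply Cmod_ge_0; exact Hw.
Qed.

(** The rows of the interchange are the blocks, its columns the orders [D + l]. *)
Lemma tau_sum (zeta : C -> C) (s : C) : is_zeta zeta -> 1 < Re s ->
  is_series (tau s) ((s - 1) * (zeta s - dsum s n) - csum (fun j => em_coef s j * em_pow s n j) D)%C.
Proof.
intros Hz Hs.
set (A := Cmod (s - 1) + 1).
assert (HA : 0 < A) by (assert (Q := Cmod_ge_0 (s - 1)); unfold A; lra).
assert (HD : 1 - INR D < Re s) by (assert (Q := pos_INR D); lra).
eapply (series_interchange (fun k l => block_term s (lo k) (len k) D (D + l))
  _ _ (row_major (Re s)) (col_major A)).
- now apply ex_series_row_major.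
- now apply ex_series_col_major.
- intros k l; apply block_term_major; [lra|exact HA|unfold A; lra].
- intros k; apply block_series, lo_pos.
- intros l; now apply tau_series.
- now apply blocks_total.
Qed.

Lemma ex_tau_sum (s : C) : 1 - INR D < Re s -> exists L, is_series (tau s) L.
Proof.
intros Hs.
set (A := Cmod (s - 1) + 1).
assert (HA : 0 < A) by (assert (Q := Cmod_ge_0 (s - 1)); unfold A; lra).
apply (ex_series_C _ (fun l => Series (row_major (Re s)) * col_major A l)).
- now apply ex_series_scal_R, ex_series_col_major.
- intros l; apply tau_major; [exact Hs|lra|exact HA|unfold A; lra].
Qed.

Lemma cdiff_tau (z : C) (l : nat) : 1 - INR D < Re z -> cdiff (fun s => tau s l) z.
Proof.
intros Hz; unfold tau, inner.
assert (Did : cdiff (fun s => s - 1)%C z).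
{ apply (cdiff_minus (fun s => s)); [apply cdiff_id|apply cdiff_const]. }
apply cdiff_mult; [apply cdiff_npow, cdiff_opp, cdiff_id|].
apply cdiff_mult.
- apply cdiff_mult; [|apply cdiff_const]; now apply (cdiff_rho (fun s => s - 1)%C).
- apply cdiff_csum; intros k Hk.
  apply cdiff_mult; [apply cdiff_const|].
  apply cdiff_mult; [apply cdiff_const|].
  apply cdiff_inv.
  + apply npow_gap; [exact Hp|]; rewrite plus_INR; assert (A := pos_INR k); lra.
  + apply cdiff_minus; [apply cdiff_npow, cdiff_id|apply cdiff_const].
Qed.

(** The formula of the theorem, multiplied by [s - 1] and solved for the sum of [tau s]. *)
Definition head (zeta : C -> C) (s : C) : C :=
  ((s - 1) * (zeta s - dsum s n) - csum (fun j => em_coef s j * em_pow s n j) D)%C.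

Lemma cdiff_head (zeta : C -> C) (z : C) : is_zeta zeta -> z <> RtoC 1 -> cdiff (head zeta) z.
Proof.
intros [_ [Hz _]] Hz1; unfold head, dsum, em_coef, em_pow.
assert (Did : cdiff (fun s => s - 1)%C z).
{ apply (cdiff_minus (fun s => s)); [apply cdiff_id|apply cdiff_const]. }
apply cdiff_minus.
- apply cdiff_mult; [exact Did|].
  apply cdiff_minus; [now apply ex_derive_cdiff, Hz|].
  apply cdiff_csum; intros k _; apply cdiff_npow, cdiff_opp, cdiff_id.
- apply cdiff_csum; intros j _; apply cdiff_mult.
  + apply cdiff_mult; [|apply cdiff_const]; now apply (cdiff_rho (fun s => s - 1)%C).
  + apply cdiff_npow, (cdiff_minus (fun s => 1 - s)%C); [|apply cdiff_const].
    apply (cdiff_minus (fun _ => RtoC 1)); [apply cdiff_const|apply cdiff_id].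
Qed.

(** [T] chooses the sum of [tau s] as a function of [s], arbitrary where the series diverges.
    [head zeta - T] vanishes for [1 < Re s] by [tau_sum], and is approximated by replacing [T] with
    partial sums, which are holomorphic. *)
Lemma head_tau (zeta : C -> C) (s L : C) : is_zeta zeta ->
  1 - INR D < Re s -> s <> RtoC 1 -> is_series (tau s) L -> head zeta s = L.
Proof.
intros Hzeta.
set (T := fun s => epsilon (inhabits (RtoC 0)) (fun L => is_series (tau s) L)).
assert (HT : forall s, 1 - INR D < Re s -> is_series (tau s) (T s)).
{ intros z Hz; unfold T; apply epsilon_spec; now apply ex_tau_sum. }
assert (Un : forall z l m, is_series (tau z) l -> is_series (tau z) m -> l = m).
{ intros z l m Hl Hm; apply (clim_unique (csum (tau z))); now apply is_series_clim. }
intros Hs Hs1 HL.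
rewrite (Un s L (T s) HL (HT s Hs)).
enough (E : (head zeta s - T s = 0)%C).
{ replace (head zeta s) with (head zeta s - T s + T s)%C by ring; rewrite E; ring. }
apply (vanish_continuation (fun s => head zeta s - T s)%C (1 - INR D)); [| |exact Hs|exact Hs1].
- intros c r Hr Hdisc eps He.
  (* On the disc [Re z >= s1] and [z - 1] has modulus at most [A], so [b] below is a common
     majorant. The leftmost point of the closed disc gives [1 - INR D < s1]. *)
  set (s1 := Re c - r).
  set (A := Cmod (c - 1) + r).
  assert (HA : 0 < A) by (assert (Q := Cmod_ge_0 (c - 1)); unfold A; lra).
  assert (Hs1' : 1 - INR D < s1).
  { destruct (Hdisc (c - RtoC r)%C) as [Q _].
    - replace (c - RtoC r - c)%C with (- RtoC r)%C by ring.
      rewrite Cmod_opp, Cmod_R, Rabs_pos_eq; lra.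
    - exact Q. }
  set (b := fun l => Series (row_major s1) * col_major A l).
  assert (Hb : ex_series b) by now apply ex_series_scal_R, ex_series_col_major.
  assert (Hl := is_lim_seq_rsum b Hb); apply is_lim_seq_spec in Hl.
  destruct (Hl (mkposreal eps He)) as [N HN].
  specialize (HN N (le_n N)); simpl in HN.
  exists (fun s => head zeta s - csum (tau s) N)%C; intros z Hz.
  destruct (Hdisc z (Rlt_le _ _ Hz)) as [Hz1 Hz2].
  split.
  + apply cdiff_minus; [now apply cdiff_head|].
    apply (cdiff_csum (fun l s => tau s l)); intros l _; now apply cdiff_tau.
  + replace (head zeta z - csum (tau z) N - (head zeta z - T z))%C
      with (T z - csum (tau z) N)%C by ring.
    eapply Rle_trans; [apply (is_series_tail_le _ _ b N (HT z Hz1) Hb)|].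
    * intros l; apply tau_major; [exact Hs1'| |exact HA|].
      -- assert (Q := re_le_Cmod (z - c)%C); apply Rabs_le_between in Q.
         replace (Re (z - c)%C) with (Re z - Re c) in Q by reflexivity; unfold s1; lra.
      -- replace (z - 1)%C with ((z - c) + (c - 1))%C by ring.
         eapply Rle_trans; [apply Cmod_triangle|]; unfold A; lra.
    * rewrite Rabs_minus_sym in HN; left; eapply Rle_lt_trans; [apply Rle_abs|exact HN].
- intros z Hz; rewrite (Un z (T z) (head zeta z)); [ring| |now apply tau_sum].
  apply HT; assert (Q := pos_INR D); lra.
Qed.

End Blocks.

(** * The formula in the notation of the theorem *)

Lemma sum_n_m_dsum (n : nat) (s : C) : (1 <= n)%nat ->
  sum_n_m (fun j => (/ npow j s)%C) 1 n = dsum s n.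
Proof.
intros Hn; replace n with (1 + (n - 1))%nat at 1 by lia.
rewrite sum_n_m_csum; replace (S (n - 1)) with n by lia.
apply csum_ext; intros k _; now rewrite npow_opp.
Qed.

Lemma tau_eq (n p D : nat) (s : C) (l : nat) :
  let i := (D + l)%nat in
  (Cbinom (RtoC (INR i) + s - 1) (i + 1) / RtoC (INR (n * p)) ^ i
   * sum_n_m
       (fun j : nat =>
          RtoC (Binomial.C (i + 1) j) * RtoC (bernoulli j)
          * (RtoC (INR (n * (p - 1))) ^ (i + 1 - j)
             / (npow p s - npow p (1 - RtoC (INR j)))))
       D i)%C = (npow n s * tau n p D s l)%C.
Proof.
intros i; unfold tau; fold i.
replace (Cbinom (RtoC (INR i) + s - 1) (i + 1)) with (rho (s - 1) (S i)).
2:{ rewrite <- Cbinom_rho, Nat.add_1_r; f_equal; rewrite S_INR, RtoC_plus; ring. }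
match goal with |- context [sum_n_m ?f D i] =>
  change (sum_n_m f D i) with (sum_n_m f D (D + l)) end; rewrite sum_n_m_csum.
rewrite npow_opp.
replace (csum (fun k => inner n p s i (D + k)) (S l)) with
 (csum (fun k => (RtoC (Binomial.C (i + 1) (D + k)) * RtoC (bernoulli (D + k))
          * (RtoC (INR (n * (p - 1))) ^ (i + 1 - (D + k))
             / (npow p s - npow p (1 - RtoC (INR (D + k))))))%C) (S l)).
{ rewrite Cmult_assoc, Cinv_r by apply npow_neq_0; now rewrite Cmult_1_l. }
apply csum_ext; intros k Hk; unfold inner; rewrite Nat.add_1_r, bin_C by (unfold i; lia).
reflexivity.
Qed.

Theorem theorem11 (zeta : C -> C) (Hzeta : is_zeta zeta)
    (n p D : nat) (Hn : (1 <= n)%nat) (Hp : (2 <= p)%nat)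
    (s : C) (Hs : (1 - INR D < Re s)%R) (Hs1 : s <> RtoC 1) :
  exists L : C,
    is_series
      (fun l : nat =>
         let i := (D + l)%nat in
         (Cbinom (RtoC (INR i) + s - 1) (i + 1) / RtoC (INR (n * p)) ^ i
          * sum_n_m
              (fun j : nat =>
                 RtoC (Binomial.C (i + 1) j) * RtoC (bernoulli j)
                 * (RtoC (INR (n * (p - 1))) ^ (i + 1 - j)
                    / (npow p s - npow p (1 - RtoC (INR j)))))
              D i)%C)
      L
    /\ zeta s =
       (sum_n_m (fun j : nat => / npow j s) 1 n
        + sum_lt
            (fun k : nat =>
               Cbinom (s + RtoC (INR k) - 2) k / (s - 1)
               * (RtoC (bernoulli k) / npow n (s + RtoC (INR k) - 1)))
            D
        + / ((s - 1) * npow n s) * L)%C.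
Proof.
destruct (ex_tau_sum n p D Hn Hp s Hs) as [L0 HL0].
(* [tau] carries the factor [n^(-s)] that the theorem places in front of the series. *)
exists (npow n s * L0)%C; split.
- generalize (is_series_scal_C (npow n s) _ _ HL0); apply is_series_ext.
  intros l; on_C; symmetry; apply tau_eq.
- assert (Hs2 : (s - 1)%C <> RtoC 0).
  { intros E; apply Hs1; replace s with ((s - 1) + 1)%C by ring; rewrite E; ring. }
  rewrite sum_n_m_dsum, sum_lt_csum by exact Hn.
  rewrite (csum_ext _ (fun k => / (s - 1) * (em_coef s k * em_pow s n k))%C).
  + rewrite csum_scal, <- (head_tau n p D Hn Hp zeta s L0 Hzeta Hs Hs1 HL0); unfold head.
    field; split; [apply npow_neq_0|exact Hs2].
  + intros k _; unfold em_coef, em_pow.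
    replace (s + RtoC (INR k) - 2)%C with ((s - 1) + RtoC (INR k) - 1)%C.
    2:{ replace (RtoC 2) with (1 + 1)%C by (apply injective_projections; simpl; ring); ring. }
    rewrite Cbinom_rho.
    replace (1 - s - RtoC (INR k))%C with (- (s + RtoC (INR k) - 1))%C by ring.
    rewrite npow_opp; field; split; [apply npow_neq_0|exact Hs2].
Qed.
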